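(* Let $S$ be a closed topological surface with a cellular decomposition $\Sigma=(V,E,F)$, let $\Phi\in(0,\frac{\pi}{2})^{|E|}$ be a weight, let $1\le m\le |F|-1$ and $1\le i_1<\cdots<i_m\le |F|$, and let $\hat L=(\hat L_1,\dots,\hat L_{|F|})^T\in\mathcal{L}_{i_1\cdots i_m}$ be a prescribed total geodesic curvature on the face set $F$. For any initial geodesic curvature $k(0)\in\mathbb{R}_{>0}^{|F|}$, the solution of the prescribed combinatorial Ricci flow $$\frac{dk_i}{dt}=-(L_i-\hat L_i)k_i,\ \ i\in F_{i_1\cdots i_m},\qquad \frac{dk_i}{dt}=-L_ik_i,\ \ i\in F\setminus F_{i_1\cdots i_m},$$ where $F_{i_1\cdots i_m}=\{i_1,\dots,i_m\}$, converges as $t\to+\infty$ to the unique, up to isometry, degenerated circle pattern metric with total geodesic curvature $\hat L$. Moreover, if the solution converges to the degenerated circle pattern metric $\hat k$, then $\hat k\in\mathbb{R}^{|F|}_{i_1\cdots i_m}$.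
   Context: Cellular decomposition: $V,E,F$ are the finite sets of 0-, 1- and 2-cells of $\Sigma$, and $F=\{1,\dots,|F|\}$. For $f\in F$, $E_f$ is the set of 1-cells contained in $\partial f$ (every face has at least one such 1-cell). For $F'\subset F$, $E_{F'}=\{e\in E : \exists f\in F',\ e\in E_f\}$. The 2-cells on the two sides of $e\in E$ are denoted $f_1(e),f_2(e)$ (possibly equal). Bigons: for $r_1,r_2\in(0,\frac{\pi}{2}]$ and $\phi\in(0,\frac{\pi}{2})$, there are round disks $D_1,D_2\subset\mathbb{S}^2$ (unit sphere) of radii $r_1,r_2$, unique up to isometry, such that $D_1\cap D_2$ is a bigon with interior angle $\phi$; the distance $r_3$ between the centers satisfies $\cos r_3=\cos r_1\cos r_2-\sin r_1\sin r_2\cos\phi$. The two sides of the bigon are arcs of $\partial D_1$ and $\partial D_2$, of lengths $\ell_1,\ell_2$. The geodesic curvature of $\partial D_i$ is $k_i=\cot r_i\ge 0$, and the total geodesic curvature of the side on $\partial D_i$ is $\ell_ik_i$. Metrics: given radii $\mathbf r=(r_1,\dots,r_{|F|})\in(0,\frac{\pi}{2}]^{|F|}$, choose an auxiliary point in each 2-cell and join it to the vertices on the boundary of that 2-cell; for $e\in E$ let $Q(e)$ be the quadrilateral whose vertices are the end points of $e$ and the auxiliary points of the two 2-cells adjacent to $e$. Give $Q(e)$ the spherical metric of the quadrilateral whose vertices are the centers of two disks in $\mathbb{S}^2$ of radii $r_{f_1(e)},r_{f_2(e)}$ with intersection angle $\Phi(e)$ (interior angle of the bigon $B_e$ formed by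 their intersection) and the two intersection points of their boundary circles. Gluing the $Q(e)$ along their sides gives a spherical conical metric on $S$ together with a circle pattern realizing $\Phi$. Put $k_f=\cot r_f$; the metric with its circle pattern is identified with the vector $k=(k_1,\dots,k_{|F|})^T\in\mathbb{R}_{\ge0}^{|F|}$, which determines it up to isometry, so that ''unique up to isometry'' means that $k$ is unique, and convergence of metrics means convergence of the vectors $k$ in $\mathbb{R}^{|F|}$. It is called a degenerated circle pattern metric if some $k_f=0$ (some $r_f=\frac{\pi}{2}$). Total geodesic curvature: for $e\in E_f$, $L_{f,e}=\ell_{f,e}k_f$, where $\ell_{f,e}$ is the length of the side of $B_e$ lying on the boundary of the disk of $f$. The total geodesic curvature of $f$ is $L_f=L_f(k)=\sum_{e\in E_f}L_{f,e}$ (if $f$ lies on both sides of $e$, both sides of $B_e$ are counted). In the flow, $L_i=L_i(k(t))$. Sets: $\mathcal{L}_{i_1\cdots i_m}$ is the set of all $(L_1,\dots,L_{|F|})^T\in\mathbb{R}^{|F|}$ with $L_{i_j}>0$ for $1\le j\le m$, $L_i=0$ for $i\notin F_{i_1\cdots i_m}$, and $\sum_{f\in F'}L_f<2\sum_{e\in E_{F'}}\Phi(e)$ for every nonempty $F'\subset F_{i_1\cdots i_m}$. $\mathbb{R}^{|F|}_{i_1\cdots i_m}$ is the set of $k\in\mathbb{R}^{|F|}$ with $k_{i}>0$ for $i\in F_{i_1\cdots i_m}$ and $k_i=0$ otherwise. *)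

(* Defs.v *)
From HB Require Import structures.
From mathcomp Require Import all_boot all_order all_algebra.
From mathcomp Require Import all_classical all_reals all_analysis.
From mathcomp Require Import ring.

Set Implicit Arguments.
Unset Strict Implicit.
Unset Printing Implicit Defensive.

Import Order.TTheory GRing.Theory Num.Theory.
Import numFieldNormedType.Exports.

Local Open Scope classical_set_scope.
Local Open Scope ring_scope.

(** * Closed surfaces and cellular decompositions *)

Definition open_embedding (T U : topologicalType) (h : T -> U) : Prop :=
  [/\ continuous h, injective h & forall A, open A -> open (h @` A)].

(* Connectedness is not required. Second countability follows from
   compactness and the existence of charts. *)
Definition closed_surface (R : realType) (S : topologicalType) : Prop :=
  [/\ hausdorff_space S, compact [set: S] &
      forall x : S, exists2 h : R * R -> S, open_embedding h & range h x].

Section Cells.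
Variable R : realType.

Definition closed_disk : set (R * R) := [set p | p.1 ^+ 2 + p.2 ^+ 2 <= 1].
Definition open_disk : set (R * R) := [set p | p.1 ^+ 2 + p.2 ^+ 2 < 1].
Definition unit_circle : set (R * R) := [set p | p.1 ^+ 2 + p.2 ^+ 2 = 1].

(* A finite CW structure of dimension 2, given by characteristic maps. In a
   Hausdorff space these maps are automatically homeomorphisms from the open
   interval (the open disk) onto the corresponding open cell. *)
Record cellular_decomposition (S : topologicalType) (V E F : finType) :=
  CellularDecomposition {
    vertex : V -> S ;
    edge_map : E -> R -> S ;
    face_map : F -> R * R -> S ;
    cell (c : V + E + F) : set S :=
      match c with
      | inl (inl v) => [set vertex v]
      | inl (inr e) => edge_map e @` `]0, 1[
      | inr f => face_map f @` open_disk
      end ;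
    edge_map_continuous : forall e, {within `[0, 1], continuous (edge_map e)} ;
    edge_map_inj : forall e, set_inj `]0, 1[ (edge_map e) ;
    edge_map_ends : forall e,
      range vertex (edge_map e 0) /\ range vertex (edge_map e 1) ;
    face_map_continuous : forall f,
      {within closed_disk, continuous (face_map f)} ;
    face_map_inj : forall f, set_inj open_disk (face_map f) ;
    face_map_boundary : forall f p, unit_circle p ->
      exists c : V + E, cell (inl c) (face_map f p) ;
    cell_disjoint : trivIset [set: V + E + F] cell ;
    cell_cover : \bigcup_c cell c = [set: S]
  }.

Section Incidence.
Variables (S : topologicalType) (V E F : finType).
Variable X : cellular_decomposition S V E F.

Definition edge_cell (e : E) : set S := cell X (inl (inr e)).
Definition face_cell (f : F) : set S := cell X (inr f).

(* [E_f]: the edges contained in the boundary of the face [f]. *)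
Definition boundary_edges (f : F) : {set E} :=
  [set e | `[< edge_cell e `<=` closure (face_cell f) `\` face_cell f >]]%SET.

(* The 2-cells on the two sides of [e] are [f] and [g]: the open 1-cell [e]
   has a bicollar, i.e. a neighbourhood homeomorphic to a plane in which [e]
   is the horizontal axis, with [f] above it and [g] below it. Every 1-cell
   of a cellular decomposition of a surface has one. *)
Definition two_sides (e : E) (f g : F) : Prop :=
  exists h : R * R -> S,
    [/\ open_embedding h,
        h @` [set p | p.2 = 0] = edge_cell e,
        h @` [set p | p.2 > 0] `<=` face_cell f &
        h @` [set p | p.2 < 0] `<=` face_cell g].

End Incidence.
End Cells.

(** * Bigons on the unit sphere *)

Section Bigon.
Variable R : realType.
Implicit Types (u v p : 'rV[R]_3) (r phi k : R).

Definition point3 (x y z : R) : 'rV[R]_3 := \row_(i < 3) [:: x; y; z]`_i.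
Definition dot u v : R := \sum_i u 0 i * v 0 i.

Definition sphere2 : set 'rV[R]_3 := [set p | dot p p = 1].
Definition sphere_dist u v : R := acos (dot u v).
Definition round_disk v r : set 'rV[R]_3 :=
  [set p | sphere2 p /\ sphere_dist v p <= r].

(* The distance [r_3] between the centers of two disks of radii [r1], [r2]
   whose intersection is a bigon of interior angle [phi]; see [bigon_angle]. *)
Definition center_dist r1 r2 phi : R :=
  acos (cos r1 * cos r2 - sin r1 * sin r2 * cos phi).

Definition center1 : 'rV[R]_3 := point3 0 0 1.
Definition center2 r1 r2 phi : 'rV[R]_3 :=
  let r3 := center_dist r1 r2 phi in point3 (sin r3) 0 (cos r3).

(* Parametrization, with constant speed [sin r], of the boundary of
   [round_disk center1 r]. *)
Definition boundary_circle r (t : R) : 'rV[R]_3 :=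
  point3 (sin r * cos t) (sin r * sin t) (cos r).

(* The length [l_1] of the side of the bigon which lies on the boundary of the
   first disk, i.e. of the arc of that boundary inside the second disk. As the
   bigon is unique up to isometry, [l_2] is [side_length r2 r1 phi]. *)
Definition side_length r1 r2 phi : R :=
  sin r1 * fine (lebesgue_measure
    [set t : R | t \in `[- pi, pi] /\
       round_disk (center2 r1 r2 phi) r2 (boundary_circle r1 t)]).

(* The radius in (0, pi/2] of a disk whose boundary has geodesic curvature
   [k >= 0], i.e. the inverse function of cot; see [cot_radius]. *)
Definition radius k : R := pi / 2 - atan k.

(* Total geodesic curvature of the side on the disk of curvature [k1]. *)
Definition side_curvature phi k1 k2 : R :=
  side_length (radius k1) (radius k2) phi * k1.

Lemma cot_radius k : cos (radius k) / sin (radius k) = k.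
Proof.
rewrite /radius cosB sinB cos_pihalf sin_pihalf !mul0r !mul1r add0r subr0.
by rewrite -[RHS](@atanK R).
Qed.

Lemma dot_tangent u v p (a b : R) :
  dot (u - a *: p) (v - b *: p) =
  dot u v - b * dot u p - a * dot v p + a * b * dot p p.
Proof.
rewrite /dot !mulr_sumr -!sumrB -big_split /=; apply: eq_bigr => i _.
by rewrite !mxE; ring.
Qed.

Lemma dot_centers r1 r2 phi :
  dot center1 (center2 r1 r2 phi) =
  cos r1 * cos r2 - sin r1 * sin r2 * cos phi.
Proof.
rewrite /dot !big_ord_recl big_ord0 !mxE /= !mul0r mul1r !add0r addr0.
rewrite /center_dist acosK // in_itv /= -ler_norml.
rewrite -(@ler_pXn2r _ 2) ?nnegrE // expr1n real_normK ?num_real //.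
have e1 := cos2Dsin2 r1; have e2 := cos2Dsin2 r2; have e3 := cos2Dsin2 phi.
have -> : 1 = (cos r1 * cos r2 - sin r1 * sin r2 * cos phi) ^+ 2 +
  (cos r1 * sin r2 * cos phi + sin r1 * cos r2) ^+ 2 +
  (sin r2 * sin phi) ^+ 2 :> R.
  transitivity ((cos r1 ^+ 2 + sin r1 ^+ 2) *
    (cos r2 ^+ 2 + sin r2 ^+ 2 * cos phi ^+ 2) +
    sin r2 ^+ 2 * sin phi ^+ 2); last by ring.
  by rewrite e1 mul1r -addrA -mulrDr e3 mulr1 e2.
by rewrite -addrA lerDl addr_ge0 // sqr_ge0.
Qed.

(* At a common point [p] of the two boundary circles the tangent vectors
   [c1 - cos r1 p], [c2 - cos r2 p], of lengths [sin r1], [sin r2], which point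
   towards the centers, make the angle [pi - phi]: the interior angle of the
   bigon at [p] is [phi]. *)
Lemma bigon_angle r1 r2 phi p :
  let c1 := center1 in let c2 := center2 r1 r2 phi in
  sphere2 p -> dot c1 p = cos r1 -> dot c2 p = cos r2 ->
  dot (c1 - cos r1 *: p) (c2 - cos r2 *: p) = sin r1 * sin r2 * cos (pi - phi).
Proof.
move=> c1 c2 pp c1p c2p.
rewrite dot_tangent dot_centers c1p c2p pp cosB cospi sinpi.
by ring.
Qed.

End Bigon.

(** * Circle pattern metrics, total geodesic curvatures and the flow *)

Section Metrics.
Variables (R : realType) (E : finType) (n : nat).

(* A circle pattern metric is given by the vector of the geodesic curvatures
   of its circles. *)
Definition circle_pattern_metric : set 'cV[R]_n :=
  [set k | forall f, 0 <= k f 0].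

Definition degenerated_metric : set 'cV[R]_n :=
  [set k | circle_pattern_metric k /\ exists f, k f 0 = 0].

Definition positive_on (I : {set 'I_n}) : set 'cV[R]_n :=
  [set k | (forall f, f \in I -> 0 < k f 0) /\
           (forall f, f \notin I -> k f 0 = 0)].

Variables (bd : 'I_n -> {set E}) (f1 f2 : E -> 'I_n) (Phi : E -> R).

Definition edges_of (F' : {set 'I_n}) : {set E} :=
  [set e | [exists f in F', e \in bd f]]%SET.

(* The two conditionals count the two sides of the bigon of [e]; both
   contribute when [f] lies on both sides of [e]. *)
Definition total_curvature (k : 'cV[R]_n) : 'cV[R]_n :=
  \col_f \sum_(e in bd f)
    ((if f1 e == f then side_curvature (Phi e) (k (f1 e) 0) (k (f2 e) 0)
      else 0) +
     (if f2 e == f then side_curvature (Phi e) (k (f2 e) 0) (k (f1 e) 0)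
      else 0)).

Definition admissible_curvature (I : {set 'I_n}) : set 'cV[R]_n :=
  [set L | [/\ forall f, f \in I -> 0 < L f 0,
               forall f, f \notin I -> L f 0 = 0 &
               forall F' : {set 'I_n}, F' != finset.set0 -> F' \subset I ->
                 \sum_(f in F') L f 0 < 2 * \sum_(e in edges_of F') Phi e]].

Definition flow_field (I : {set 'I_n}) (Lhat k : 'cV[R]_n) : 'cV[R]_n :=
  \col_f (if f \in I
          then - (total_curvature k f 0 - Lhat f 0) * k f 0
          else - total_curvature k f 0 * k f 0).

(* Only the restriction of [k] to [0, +oo) is meaningful. *)
Definition flow_solution (I : {set 'I_n}) (Lhat k0 : 'cV[R]_n)
    (k : R -> 'cV[R]_n) : Prop :=
  [/\ k 0 = k0,
      forall t : R, 0 <= t -> circle_pattern_metric (k t),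
      {within `[0, +oo[, continuous k} &
      forall t : R, 0 < t -> forall f,
        is_derive t 1 (fun s : R => k s f 0) (flow_field I Lhat (k t) f 0)].

End Metrics.

(* Main.v *)
Require Import Defs.
From mathcomp Require Import all_boot all_order all_algebra.
From mathcomp Require Import all_classical all_reals all_analysis.
From mathcomp Require Import ring lra.
Import Order.TTheory GRing.Theory Num.Theory.
Import numFieldNormedType.Exports.
Local Open Scope classical_set_scope.
Local Open Scope ring_scope.

Set Implicit Arguments.
Unset Strict Implicit.
Unset Printing Implicit Defensive.

(** The theorem follows from the order structure of the flow, through maximum
principles.

One side of a bigon contributes the elementary function [bigon_curvature] of
the two geodesic curvatures ([side_curvatureE]).  It decreases in the curvature
of the neighbour, and it increases strictly when both curvatures are multiplied
by the same factor larger than 1.  Hence the total curvature [curv u f] of a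
face decreases in the curvatures of the other faces and increases strictly
under scaling; that is, in the variables [K = ln k] the flow
[K' = lam - curv (exp K)] is cooperative, and contracting along the uniform
translations of [K].  Three consequences carry the theorem.

- Uniqueness.  If two metrics have the same total curvatures, compare them at
  the face where their ratio is extremal ([curv_comparison]).  A face has
  curvature 0 exactly when its total curvature is 0, so that the support of the
  limit metric is the prescribed set of faces.

- Existence.  For positive prescribed curvatures the supremum of all
  subsolutions is a solution ([curv_surjective]).  The upper bounds on the
  sums of prescribed curvatures are what keeps the subsolutions bounded: on a
  set of faces whose curvatures blow up, the total curvatures add up in the
  limit to twice the sum of the angles of the incident edges.  A prescribed
  vector with zero entries is reached by adding [eps] to all its entries and
  letting the solutions decrease to their infimum as [eps] tends to 0
  ([curv_degenerate]).

- Convergence.  The solution for [lam + eps] is a strict supersolution, so the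
  largest value of [K - ln u] decreases at rate at least [eps] as long as it is
  positive, and the flow is eventually below [u] up to a factor close to 1.
  The degenerate solution shrunk by a factor smaller than 1 is a strict
  subsolution, and it bounds the flow from below ([flow_converges]).

The logarithmic flow is globally Lipschitz, because the logarithmic derivatives
of [bigon_curvature] are bounded; Picard iteration therefore gives a solution
for all positive times ([global_solution]).  Conversely a solution of the flow
in the variables [k] stays positive, and a Gronwall estimate identifies it with
this one ([flow_unique]).  The surface enters through [mem_boundary_edges]:
an edge lies on the boundary of a face exactly when the face is on one of
its two sides. *)

(** * The length of a side of a bigon *)

Section BigonSides.
Variable R : realType.
Implicit Types (r t phi k : R).

Lemma dot_point3 (x y z x' y' z' : R) :
  dot (point3 x y z) (point3 x' y' z') = x * x' + y * y' + z * z'.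
Proof.
by rewrite /dot !big_ord_recl big_ord0 !mxE /= addr0 addrA.
Qed.

Lemma le_acos_cos (d r : R) : -1 <= d <= 1 -> 0 <= r <= pi ->
  (acos d <= r) = (cos r <= d).
Proof.
move=> d1 r1; rewrite -[in RHS](acosK d1).
rewrite !leNgt ltr_cos //; by rewrite in_itv /= acos_ge0 ?acos_lepi.
Qed.

Lemma le_cos_norm (psi t : R) : 0 <= psi <= pi -> `|t| <= pi ->
  (cos psi <= cos t) = (`|t| <= psi).
Proof.
move=> h1 h2; rewrite -[X in _ <= X](@cos_norm R t).
rewrite !leNgt ltr_cos //; by rewrite in_itv /= ?normr_ge0.
Qed.

(** In the spherical triangle formed by the two centers and a vertex of the
bigon, the angle at the first center is given by the cotangent formula; the
arc is seen from that center under twice this angle. *)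
Lemma side_lengthE r1 r2 phi :
  0 < r1 <= pi / 2 -> 0 < r2 <= pi / 2 -> 0 < phi < pi / 2 ->
  side_length r1 r2 phi = sin r1 *
    (2 * (pi / 2 - atan ((cos r2 * sin r1 + cos r1 * sin r2 * cos phi)
                         / (sin r2 * sin phi)))).
Proof.
move=> /andP[r1gt0 r1le] /andP[r2gt0 r2le] /andP[phigt0 philt].
have pi0 := @pi_gt0 R.
have s1 : 0 < sin r1 by apply: sin_gt0_pi; lra.
have s2 : 0 < sin r2 by apply: sin_gt0_pi; lra.
have s : 0 < sin phi by apply: sin_gt0_pi; lra.
have c1 : 0 <= cos r1 by apply: cos_ge0_pihalf; lra.
have c2 : 0 <= cos r2 by apply: cos_ge0_pihalf; lra.
have c : 0 <= cos phi by apply: cos_ge0_pihalf; lra.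
set u := cos r2 * _ + _; set v := sin r2 * sin phi; set b := atan _.
have u0 : 0 <= u by rewrite addr_ge0 ?mulr_ge0 // ltW.
have v0 : 0 < v by rewrite mulr_gt0.
have b0 : 0 <= b.
  by rewrite -(@atan0 R); apply: le_atan; rewrite divr_ge0 // ltW.
have bpi : b < pi / 2 by exact: atan_ltpi2.
have cb : 0 < cos b by apply: cos_gt0_pihalf; lra.
have tb : v * sin b = u * cos b.
  have := @atanK R (u / v); rewrite -/b /tan => h.
  by rewrite -[sin b](divfK (lt0r_neq0 cb)) h; field; rewrite lt0r_neq0.
have eb := cos2Dsin2 b.
(* [w] will be the sine of the distance between the centers. *)
pose w := u * sin b + v * cos b.
have wsin : w * sin b = u.
  rewrite /w mulrDl -mulrA -expr2 [v * _ * _]mulrAC tb -mulrA -expr2.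
  by rewrite -mulrDr addrC eb mulr1.
have wcos : w * cos b = v.
  rewrite /w mulrDl [u * _ * _]mulrAC -tb -[in X in _ + X]mulrA -mulrA -!expr2.
  by rewrite -mulrDr addrC eb mulr1.
have w0 : 0 < w by rewrite -(pmulr_lgt0 _ cb) wcos.
have ww : w ^+ 2 = u ^+ 2 + v ^+ 2.
  by rewrite -{1}wsin -wcos !exprMn -mulrDr addrC eb mulr1.
have e1 := cos2Dsin2 r1; have e2 := cos2Dsin2 r2; have e3 := cos2Dsin2 phi.
set X := cos r1 * cos r2 - sin r1 * sin r2 * cos phi.
have XX : X ^+ 2 + w ^+ 2 = 1.
  rewrite ww; transitivity ((cos r1 ^+ 2 + sin r1 ^+ 2) *
    (cos r2 ^+ 2 + sin r2 ^+ 2 * cos phi ^+ 2) +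
    sin r2 ^+ 2 * sin phi ^+ 2); first by rewrite /X /u /v; ring.
  by rewrite e1 mul1r -addrA -mulrDr e3 mulr1 e2.
have X1 : -1 <= X <= 1.
  rewrite -ler_norml -(@ler_pXn2r _ 2) ?nnegrE // expr1n real_normK ?num_real //.
  by rewrite -XX lerDl sqr_ge0.
have cX : cos (acos X) = X by rewrite acosK.
have sX : sin (acos X) = w.
  rewrite sin_acos // -XX [X in Num.sqrt X](_ : _ = w ^+ 2); last by ring.
  by rewrite sqrtr_sqr ger0_norm // ltW.
have rng t : -1 <= w * (sin r1 * cos t) + X * cos r1 <= 1.
  rewrite -ler_norml -(@ler_pXn2r _ 2) ?nnegrE // expr1n real_normK ?num_real //.
  have et := cos2Dsin2 t.
  have -> : 1 = (w * (sin r1 * cos t) + X * cos r1) ^+ 2 +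
     ((X * sin r1 - w * cos r1 * cos t) ^+ 2 + (w * sin t) ^+ 2).
    transitivity ((X ^+ 2 + w ^+ 2 * cos t ^+ 2) * (cos r1 ^+ 2 + sin r1 ^+ 2)
       + w ^+ 2 * sin t ^+ 2); last by ring.
    by rewrite e1 mulr1 -addrA -mulrDr et mulr1 XX.
  by rewrite lerDl addr_ge0 // sqr_ge0.
(* A point of the first circle lies in the second disk when its longitude is
   at most the half-angle [pi / 2 - b]. *)
have inD2 t : `|t| <= pi ->
    (acos (w * (sin r1 * cos t) + X * cos r1) <= r2) = (`|t| <= pi / 2 - b).
  move=> tpi; rewrite le_acos_cos //; last lra.
  have -> : cos r2 = sin r1 * u + X * cos r1.
    by rewrite /X /u -[LHS]mul1r -e1; ring.
  rewrite lerD2r mulrCA ler_pM2l // -wsin ler_pM2l //.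
  rewrite -(cosBpihalf b) -cosN opprB le_cos_norm //; lra.
congr (_ * _).
have -> : [set t : R | t \in `[- pi, pi] /\
    round_disk (center2 r1 r2 phi) r2 (boundary_circle r1 t)] =
    [set` `[- (pi / 2 - b), pi / 2 - b]].
  apply/seteqP; split => t /=; rewrite /round_disk /sphere_dist /center2 /=;
    rewrite /center_dist -/X cX sX /boundary_circle dot_point3 mul0r addr0;
    rewrite !in_itv /= -!ler_norml.
    by move=> [tpi [_]]; rewrite inD2.
  move=> tb'; have tpi : `|t| <= pi by lra.
  split => //; split; last by rewrite inD2.
  rewrite /sphere2 /= dot_point3 -!expr2 !exprMn -mulrDr.
  by rewrite cos2Dsin2 mulr1 addrC.
rewrite lebesgue_measure_itv /= lte_fin ifT; last lra.
by rewrite -EFinD /=; ring.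
Qed.

End BigonSides.

(** * Mean value estimates and the arccotangent *)

Section MeanValue.
Variable R : realType.
Implicit Types (f df : R -> R) (x y c : R).

Lemma is_derive_continuous f x d : is_derive x 1 f d -> {for x, continuous f}.
Proof. by move=> h; apply/differentiable_continuous/derivable1_diffP. Qed.

Lemma MVT_line f df x y : (forall z : R, is_derive z 1 f (df z)) -> x < y ->
  exists c, f y - f x = df c * (y - x).
Proof.
move=> fdf xy.
have cf : {within `[x, y], continuous f}.
  by apply: continuous_subspaceT => z; exact: is_derive_continuous.
by have [c _ E] := MVT xy (fun z _ => fdf z) cf; exists c.
Qed.

Lemma is_derive_lt f df x y : (forall z : R, is_derive z 1 f (df z)) ->
  (forall z, 0 < df z) -> x < y -> f x < f y.
Proof.
move=> fdf df0 xy; have [c E] := MVT_line fdf xy.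
by rewrite -subr_gt0 E mulr_gt0 // subr_gt0.
Qed.

Lemma is_derive_lipschitz f df c x y : (forall z : R, is_derive z 1 f (df z)) ->
  (forall z, `|df z| <= c) -> `|f x - f y| <= c * `|x - y|.
Proof.
move=> fdf dfc.
wlog xy : x y / x < y.
  move=> hw; case: (ltgtP x y) => [||->]; first exact: hw.
    by move=> /hw; rewrite distrC [`|y - x|]distrC.
  by rewrite !subrr normr0 mulr0.
have [z E] := MVT_line fdf xy.
by rewrite distrC E normrM distrC ler_wpM2r.
Qed.

End MeanValue.

Section Arccot.
Variable R : realType.
Implicit Types (x y b : R).

Definition acot x : R := pi / 2 - atan x.

Lemma acot_gt0 x : 0 < acot x.
Proof. by rewrite subr_gt0 atan_ltpi2. Qed.

Lemma acot_le_pihalf x : 0 <= x -> acot x <= pi / 2.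
Proof. by move=> x0; rewrite gerBl -(@atan0 R) le_atan. Qed.

Lemma le_acot x y : x <= y -> acot y <= acot x.
Proof. by move=> xy; rewrite lerB // le_atan. Qed.

Lemma acotK x : cos (acot x) = x * sin (acot x).
Proof.
rewrite /acot cosB sinB cos_pihalf sin_pihalf !mul0r !mul1r add0r subr0.
have cb : 0 < cos (atan x).
  by apply: cos_gt0_pihalf; rewrite atan_gtNpi2 atan_ltpi2.
have /(congr1 ( *%R^~ (cos (atan x)))) := @atanK R x.
by rewrite /= /tan divfK // lt0r_neq0.
Qed.

Lemma cotK b : 0 < b < pi -> acot (cos b / sin b) = b.
Proof.
move=> /andP[b0 bpi].
have -> : cos b / sin b = tan (pi / 2 - b).
  by rewrite /tan cosB sinB cos_pihalf sin_pihalf !mul0r !mul1r add0r subr0.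
rewrite /acot tanK; first by ring.
by rewrite in_itv /=; apply/andP; split; lra.
Qed.

Lemma is_derive_acot x : is_derive x 1 acot (- (1 + x ^+ 2)^-1).
Proof.
have := is_deriveB (is_derive_cst (pi / 2) x 1) (is_derive1_atan x).
by rewrite sub0r.
Qed.

Lemma lt_sin x : 0 < x -> sin x < x.
Proof.
move=> x0; have xx : 0 <= x by exact: ltW.
have [|x1] := lerP x 1; last by apply: le_lt_trans x1; exact: sin_le1.
move=> x1.
have cf : {within `[0, x], continuous (@sin R)}.
  by apply: continuous_subspaceT => z; exact: continuous_sin.
have [c] := MVT x0 (fun z _ => is_derive_sin z) cf.
rewrite in_itv /= sin0 !subr0 => /andP[c0 cx] ->.
rewrite gtr_pMl // -(@cos0 R) ltr_cos // in_itv /=.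
  by rewrite lexx pi_ge0.
by rewrite ltW //=; have := @pi_ge2 R; lra.
Qed.

(** With [b = acot x] this is [cos b * sin b < b].  It is the strict
inequality behind the growth of [bigon_curvature] under scaling. *)
Lemma acot_gt x : 0 <= x -> x / (1 + x ^+ 2) < acot x.
Proof.
move=> x0; set b := acot x.
have eb := cos2Dsin2 b.
have hb : cos b = x * sin b by exact: acotK.
have b0 : 0 < b by exact: acot_gt0.
have bpi : b <= pi / 2 by exact: acot_le_pihalf.
have x1 : 0 < 1 + x ^+ 2 by rewrite ltr_pwDl // sqr_ge0.
have -> : x / (1 + x ^+ 2) = cos b * sin b.
  apply: (mulIf (lt0r_neq0 x1)); rewrite divfK ?lt0r_neq0 //.
  rewrite hb; rewrite hb in eb.
  by rewrite -[LHS]mulr1 -[X in x * X = _]eb; ring.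
apply: le_lt_trans (lt_sin b0).
rewrite ler_piMl ?cos_le1 // sin_ge0_pi //.
by have := @pi_gt0 R; lra.
Qed.

End Arccot.

(** * The total geodesic curvature of a side of a bigon *)

Section BigonCurvature.
Variable R : realType.
Implicit Types (k x y a q : R).

Lemma cos_atan_gt0 x : 0 < cos (atan x).
Proof. by apply: cos_gt0_pihalf; rewrite atan_gtNpi2 atan_ltpi2. Qed.

Lemma sin_atan x : sin (atan x) = x * cos (atan x).
Proof.
have /(congr1 ( *%R^~ (cos (atan x)))) := @atanK R x.
by rewrite /= /tan divfK // lt0r_neq0 // cos_atan_gt0.
Qed.

Lemma sin_atan_ge0 x : 0 <= x -> 0 <= sin (atan x).
Proof. by move=> x0; rewrite sin_atan mulr_ge0 // ltW // cos_atan_gt0. Qed.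

Lemma sin_atan_gt0 x : 0 < x -> 0 < sin (atan x).
Proof. by move=> x0; rewrite sin_atan mulr_gt0 // cos_atan_gt0. Qed.

Lemma cos2_atan x : cos (atan x) ^+ 2 = (1 + x ^+ 2)^-1.
Proof.
by rewrite -[in RHS](@atanK R x) -cos2_tan2 ?invrK // lt0r_neq0 // cos_atan_gt0.
Qed.

Lemma le_sin_atan x y : x <= y -> sin (atan x) <= sin (atan y).
Proof.
move=> xy; rewrite leNgt ltr_sin ?in_itv /= -?leNgt ?le_atan //.
  by rewrite !ltW // ?atan_gtNpi2 ?atan_ltpi2.
by rewrite !ltW // ?atan_gtNpi2 ?atan_ltpi2.
Qed.

(** [sin (atan k)] is the cosine of the radius.  Its derivative with respect
to [ln k] is positive and bounded by 1. *)
Lemma is_derive_sin_atan_expR x :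
  is_derive x 1 (fun x => sin (atan (expR x)))
    (sin (atan (expR x)) * cos (atan (expR x)) ^+ 2).
Proof.
have h1 := is_derive1_comp (is_derive1_atan (expR x)) (is_derive_expR x).
have h2 := is_derive1_comp (is_derive_sin (atan (expR x))) h1.
apply: (is_derive_eq h2).
by rewrite -cos2_atan sin_atan; ring.
Qed.

Variable phi : R.
Hypothesis phiP : 0 < phi < pi / 2.

(** Twice the cosine of the radius of the first disk times the half-angle
under which its side is seen from its center, by the cotangent formula. *)
Definition bigon_curvature k1 k2 : R :=
  2 * sin (atan k1) *
  acot ((k2 * cos (atan k1) + sin (atan k1) * cos phi) / sin phi).

Let sphi : 0 < sin phi.
Proof. by case/andP: phiP => *; apply: sin_gt0_pi; have := @pi_gt0 R; lra. Qed.

Let cphi : 0 < cos phi.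
Proof. by case/andP: phiP => *; apply: cos_gt0_pihalf; have := @pi_gt0 R; lra. Qed.

Lemma side_curvatureE k1 k2 : 0 <= k1 -> 0 <= k2 ->
  side_curvature phi k1 k2 = bigon_curvature k1 k2.
Proof.
move=> k10 k20; rewrite /side_curvature /bigon_curvature.
have rad k : 0 <= k -> 0 < Defs.radius k <= pi / 2.
  by move=> k0; rewrite acot_gt0 acot_le_pihalf.
have sr k : sin (Defs.radius k) = cos (atan k).
  by rewrite /Defs.radius sinB cos_pihalf sin_pihalf mul0r mul1r subr0.
have cr k : cos (Defs.radius k) = sin (atan k).
  by rewrite /Defs.radius cosB cos_pihalf sin_pihalf mul0r mul1r add0r.
rewrite side_lengthE ?rad // !sr !cr -/(acot _).
rewrite [X in acot X](_ : _ =
  (k2 * cos (atan k1) + sin (atan k1) * cos phi) / sin phi).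
  by set A := acot _; rewrite [sin _]sin_atan; ring.
rewrite !sin_atan; field.
by rewrite !lt0r_neq0 // cos_atan_gt0.
Qed.

Lemma bigon_curvature0 k2 : bigon_curvature 0 k2 = 0.
Proof. by rewrite /bigon_curvature atan0 sin0 mulr0 mul0r. Qed.

Lemma bigon_curvature_gt0 k1 k2 : 0 < k1 -> 0 < bigon_curvature k1 k2.
Proof. by move=> k10; rewrite !mulr_gt0 ?sin_atan_gt0 ?acot_gt0. Qed.

Lemma bigon_curvature_ge0 k1 k2 : 0 <= k1 -> 0 <= bigon_curvature k1 k2.
Proof.
rewrite le_eqVlt => /predU1P[<-|k10]; first by rewrite bigon_curvature0.
by rewrite ltW // bigon_curvature_gt0.
Qed.

Lemma bigon_curvature_le_pi k1 k2 : 0 <= k1 -> 0 <= k2 ->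
  bigon_curvature k1 k2 <= pi.
Proof.
move=> k10 k20; rewrite /bigon_curvature -mulrA.
have a0 := sin_atan_ge0 k10; have a1 := sin_le1 (atan k1).
have y0 : 0 <= (k2 * cos (atan k1) + sin (atan k1) * cos phi) / sin phi.
  by rewrite divr_ge0 ?addr_ge0 ?mulr_ge0 // ltW // cos_atan_gt0.
have := ler_pM a0 (ltW (acot_gt0 _)) a1 (acot_le_pihalf y0).
by rewrite mul1r; lra.
Qed.

Lemma bigon_curvature_antitone k1 k2 k2' : 0 <= k1 -> k2 <= k2' ->
  bigon_curvature k1 k2' <= bigon_curvature k1 k2.
Proof.
move=> k10 k2k2'; rewrite /bigon_curvature ler_wpM2l //.
  by rewrite mulr_ge0 // sin_atan_ge0.
apply: le_acot; rewrite ler_pM2r ?invr_gt0 // lerD2r ler_wpM2r //.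
by rewrite ltW // cos_atan_gt0.
Qed.

Lemma bigon_curvature_cvg (T : Type) (F : set_system T) {FF : Filter F}
    (u v : T -> R) k1 k2 : u @ F --> k1 -> v @ F --> k2 ->
  bigon_curvature (u t) (v t) @[t --> F] --> bigon_curvature k1 k2.
Proof.
move=> uk vk; rewrite /bigon_curvature /acot.
have ak : atan (u t) @[t --> F] --> atan k1.
  exact: cvg_comp uk (@continuous_atan R _).
have sk : sin (atan (u t)) @[t --> F] --> sin (atan k1).
  exact: cvg_comp ak (@continuous_sin R _).
have ck : cos (atan (u t)) @[t --> F] --> cos (atan k1).
  exact: cvg_comp ak (@continuous_cos R _).
apply: cvgM; first by apply: cvgM => //; exact: cvg_cst.
apply: cvgB; first exact: cvg_cst.
suff : (v t * cos (atan (u t)) + sin (atan (u t)) * cos phi) / sin phi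
    @[t --> F] --> (k2 * cos (atan k1) + sin (atan k1) * cos phi) / sin phi.
  by move=> /cvg_comp; apply; exact: continuous_atan.
apply: cvgM; last exact: cvg_cst.
apply: cvgD; apply: cvgM => //; exact: cvg_cst.
Qed.

(** On a ray [k2 = q * k1] the argument of [acot] is proportional to the
prefactor [sin (atan k1)], so that only this one quantity varies along the
ray. *)
Lemma bigon_curvature_scaled q x :
  bigon_curvature (expR x) (expR x * q) =
  2 * (sin (atan (expR x)) *
    acot (sin (atan (expR x)) * ((q + cos phi) / sin phi))).
Proof.
rewrite /bigon_curvature mulrA; congr (_ * acot _).
by rewrite sin_atan; ring.
Qed.

(** Along a ray the curvature has the form [2 * a * acot (a * p)] where [a]
increases with the scale; the derivative of [a * acot (a * p)] in [a] is
positive by [acot_gt] and at most [pi / 2]. *)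
Lemma is_derive_bigon_curvature_scaled q : 0 <= q -> exists df : R -> R,
  (forall x : R, is_derive x 1
     (fun x => bigon_curvature (expR x) (expR x * q)) (df x)) /\
  forall x, 0 < df x <= pi.
Proof.
move=> q0; set p := (q + cos phi) / sin phi.
have p0 : 0 <= p by rewrite divr_ge0 ?addr_ge0 // ltW.
pose a (x : R) := sin (atan (expR x)).
pose da (x : R) := a x * cos (atan (expR x)) ^+ 2.
exists (fun x => 2 * (da x * (acot (a x * p) - a x * p / (1 + (a x * p) ^+ 2)))).
split => x; last first.
  have a0 : 0 < a x by rewrite sin_atan_gt0 // expR_gt0.
  have c0 := cos_atan_gt0 (expR x).
  have da0 : 0 < da x by rewrite mulr_gt0 // exprn_gt0.
  have da1 : da x <= 1.
    apply: mulr_ile1; [exact: ltW|exact: sqr_ge0|exact: sin_le1|].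
    by apply: exprn_ile1; [exact: ltW|exact: cos_le1].
  have ap0 : 0 <= a x * p by rewrite mulr_ge0 // ltW.
  have d0 := acot_gt ap0.
  have w0 : 0 <= a x * p / (1 + (a x * p) ^+ 2).
    by rewrite divr_ge0 // addr_ge0 // sqr_ge0.
  have w1 := acot_le_pihalf ap0.
  rewrite !mulr_gt0 ?subr_gt0 //=.
  suff : da x * (acot (a x * p) - a x * p / (1 + (a x * p) ^+ 2)) <= 1 * (pi / 2).
    by lra.
  by apply: ler_pM => //; [exact: ltW|lra|lra].
have -> : (fun x => bigon_curvature (expR x) (expR x * q)) =
    2 *: (a * (@acot R \o (fun x => a x * p))).
  by apply/funext => z; rewrite bigon_curvature_scaled.
have ha : is_derive x 1 a (da x) by exact: is_derive_sin_atan_expR.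
have hap : is_derive x 1 (fun x => a x * p) (p * da x).
  have -> : (fun x => a x * p) = p *: a by apply/funext => z; rewrite mulrC.
  exact: is_deriveZ.
have hac := @is_derive1_comp R _ (fun x => a x * p) x _ _ (is_derive_acot _) hap.
apply: is_derive_eq.
rewrite /GRing.scale /=; ring.
Qed.

Lemma bigon_curvature_scale_lt k1 k2 s : 0 < k1 -> 0 <= k2 -> 1 < s ->
  bigon_curvature k1 k2 < bigon_curvature (s * k1) (s * k2).
Proof.
move=> k10 k20 s1; have s0 : 0 < s by exact: lt_trans s1.
have q0 : 0 <= k2 / k1 by rewrite divr_ge0 // ltW.
have [df [dfP df0]] := is_derive_bigon_curvature_scaled q0.
have xy : ln k1 < ln (s * k1).
  by rewrite ltr_ln ?posrE ?mulr_gt0 // ltr_pMl.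
have := is_derive_lt dfP _ xy; rewrite !lnK ?posrE ?mulr_gt0 //.
rewrite -mulrA mulrCA divff ?lt0r_neq0 // mulr1.
by apply => z; have /andP[] := df0 z.
Qed.

Lemma bigon_curvature_scale_le k1 k2 s : 0 <= k1 -> 0 <= k2 -> 1 <= s ->
  bigon_curvature k1 k2 <= bigon_curvature (s * k1) (s * k2).
Proof.
rewrite le_eqVlt => /predU1P[<-|k10]; first by rewrite mulr0 !bigon_curvature0.
move=> k20; rewrite le_eqVlt => /predU1P[<-|s1]; first by rewrite !mul1r.
by rewrite ltW // bigon_curvature_scale_lt.
Qed.

(** The argument of [acot] is [y = expR x * A + B] with [A] and [B]
nonnegative; its derivative in [x] is at most [y], and [y / (1 + y ^ 2)] is
bounded. *)
Lemma bigon_curvature_lipschitz_right k1 x y : 0 <= k1 ->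
  `|bigon_curvature k1 (expR x) - bigon_curvature k1 (expR y)| <= 2 * `|x - y|.
Proof.
move=> k10.
pose A := cos (atan k1) / sin phi; pose B := sin (atan k1) * cos phi / sin phi.
pose a := sin (atan k1).
have a0 : 0 <= a by exact: sin_atan_ge0.
have a1 : a <= 1 by exact: sin_le1.
have A0 : 0 <= A by rewrite divr_ge0 // ltW // cos_atan_gt0.
have B0 : 0 <= B by rewrite divr_ge0 ?mulr_ge0 // ltW.
pose w (z : R) := expR z * A + B.
have -> : bigon_curvature k1 (expR x) - bigon_curvature k1 (expR y) =
   2 * a * (acot (w x) - acot (w y)).
  have wE z : (expR z * cos (atan k1) + sin (atan k1) * cos phi) / sin phi = w z.
    by rewrite /w /A /B; ring.
  by rewrite /bigon_curvature !wE -mulrBr.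
have w' (z : R) : is_derive z 1 w (A * expR z).
  have -> : w = A *: (@expR R) + cst B.
    by apply/funext => t; rewrite /w mulrC.
  by apply: is_derive_eq; rewrite addr0.
have dac (z : R) := @is_derive1_comp R _ w z _ _ (is_derive_acot (w z)) (w' z).
rewrite normrM [`|2 * a|]ger0_norm ?mulr_ge0 //.
have : `|acot (w x) - acot (w y)| <= 1 * `|x - y|.
  apply: (@is_derive_lipschitz R (@acot R \o w) _ 1 x y dac) => z.
  have e0 : 0 <= A * expR z by rewrite mulr_ge0 // expR_ge0.
  have ew : A * expR z <= w z by rewrite /w mulrC lerDl.
  have w1 : 0 < 1 + w z ^+ 2 by rewrite ltr_pwDl // sqr_ge0.
  rewrite mulNr normrN ger0_norm; last by rewrite mulr_ge0 // invr_ge0 ltW.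
  rewrite mulrC ler_pdivrMr // mul1r; apply: (le_trans ew).
  have := sqr_ge0 (w z - 1); have := sqr_ge0 (w z); rewrite sqrrB mulr1; nra.
rewrite mul1r => h; rewrite -mulrA ler_pM2l //.
by apply: le_trans (ler_wpM2l a0 h) _; rewrite ler_piMl.
Qed.

(** Any increment of the two logarithmic variables is a common translation,
which is a scaling, followed by an increment of the second variable. *)
Lemma bigon_curvature_lipschitz x y x' y' m :
  `|x - x'| <= m -> `|y - y'| <= m ->
  `|bigon_curvature (expR x) (expR y) - bigon_curvature (expR x') (expR y')|
  <= (pi + 4) * m.
Proof.
move=> xm ym.
have q0 : 0 <= expR (y - x) by exact: expR_ge0.
have [df [dfP df0]] := is_derive_bigon_curvature_scaled q0.
(* Common translation: the ratio [expR (y - x)] is fixed. *)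
have h1 : `|bigon_curvature (expR x) (expR y) -
    bigon_curvature (expR x') (expR (x' + (y - x)))| <= pi * `|x - x'|.
  have -> : expR y = expR x * expR (y - x) by rewrite -expRD; congr expR; ring.
  rewrite [expR (x' + _)]expRD.
  apply: (@is_derive_lipschitz R
    (fun z => bigon_curvature (expR z) (expR z * expR (y - x))) df _ _ _ dfP) => z.
  have /andP[d0 dpi] := df0 z.
  by rewrite gtr0_norm.
have h2 := @bigon_curvature_lipschitz_right (expR x') (x' + (y - x)) y'
  (expR_ge0 _).
have h3 : `|x' + (y - x) - y'| <= m + m.
  rewrite (_ : x' + (y - x) - y' = (y - y') - (x - x')); last by ring.
  by apply: le_trans (ler_normB _ _) _; rewrite lerD.
rewrite -(subrKA (bigon_curvature (expR x') (expR (x' + (y - x))))).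
apply: le_trans (ler_normD _ _) _.
have := ler_wpM2l (@pi_ge0 R) xm; lra.
Qed.

(** In a Euclidean triangle with two sides of ratio [q] and exterior angle
[phi] between them, these are the two other angles.  It is the limit of the
spherical picture when both disks shrink to points. *)
Lemma acot_add q : 0 < q ->
  acot ((q + cos phi) / sin phi) + acot ((q^-1 + cos phi) / sin phi) = phi.
Proof.
move=> q0; case/andP: phiP => phi0 phi1; set al := acot _.
have pi0 := @pi_gt0 R.
have y0 : 0 <= (q + cos phi) / sin phi by rewrite divr_ge0 ?addr_ge0 // ltW.
have al0 : 0 < al by exact: acot_gt0.
have al1 : al <= pi / 2 by exact: acot_le_pihalf.
have sal : 0 < sin al by apply: sin_gt0_pi; lra.
have e : q * sin al = sin (phi - al).
  have := acotK ((q + cos phi) / sin phi); rewrite -/al sinB => ->.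
  by field; rewrite lt0r_neq0.
have be : 0 < phi - al.
  rewrite ltNge; apply/negP => be.
  suff : sin (al - phi) >= 0.
    by rewrite -opprB sinN -e oppr_ge0 leNgt mulr_gt0.
  by apply: sin_ge0_pi; lra.
have sbe : 0 < sin (phi - al) by rewrite -e mulr_gt0.
suff -> : (q^-1 + cos phi) / sin phi = cos (phi - al) / sin (phi - al).
  by rewrite cotK; [ring|lra].
have e' : sin al = q^-1 * sin (phi - al) by rewrite -e mulKf // lt0r_neq0.
apply: (mulIf (lt0r_neq0 sphi)); rewrite divfK ?lt0r_neq0 //.
apply: (mulIf (lt0r_neq0 sbe)); rewrite mulrAC divfK ?lt0r_neq0 //.
by rewrite mulrDl -e'; have := sinB phi (phi - al); rewrite subKr => ->; ring.
Qed.

(** The Euclidean angle bounds the spherical one from below, since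
[sin (atan k1) <= 1].  This is sharp when [k1] tends to infinity. *)
Lemma bigon_curvature_ge k1 k2 : 0 < k1 -> 0 <= k2 ->
  2 * sin (atan k1) * acot ((k2 / k1 + cos phi) / sin phi) <= bigon_curvature k1 k2.
Proof.
move=> k10 k20; rewrite /bigon_curvature ler_wpM2l //.
  by rewrite mulr_ge0 // sin_atan_ge0 // ltW.
apply: le_acot; rewrite ler_pM2r ?invr_gt0 //.
have a1 := sin_le1 (atan k1).
rewrite [leLHS](_ : _ = sin (atan k1) * (k2 / k1 + cos phi)).
  by rewrite ler_piMl // addr_ge0 ?divr_ge0 // ltW.
by rewrite sin_atan; field; rewrite lt0r_neq0.
Qed.

End BigonCurvature.

(** * Faces with prescribed total curvature *)

Section Network.
Variables (R : realType) (E : finType) (n : nat).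
Variables (f1 f2 : E -> 'I_n) (Phi : E -> R).
Hypothesis PhiP : forall e, 0 < Phi e < pi / 2.
Hypothesis incident : forall f, exists e, f1 e = f \/ f2 e = f.
Implicit Types (u v lam : 'I_n -> R) (f g : 'I_n) (A : {set 'I_n}).

(** The sum runs over all edges: an edge contributes nothing to a face that is
on neither of its sides. *)
Definition curv u f : R := \sum_e
  ((if f1 e == f then bigon_curvature (Phi e) (u (f1 e)) (u (f2 e)) else 0) +
   (if f2 e == f then bigon_curvature (Phi e) (u (f2 e)) (u (f1 e)) else 0)).

(** The total curvature of a face decreases when the other faces get smaller
disks: the flow is a cooperative system. *)
Lemma curv_quasi u v f : 0 <= u f -> u f = v f -> (forall g, u g <= v g) ->
  curv v f <= curv u f.
Proof.
move=> uf0 uvf uv; apply: ler_sum => e _; apply: lerD.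
  case: eqP => // ->; rewrite -uvf; exact: bigon_curvature_antitone.
case: eqP => // ->; rewrite -uvf; exact: bigon_curvature_antitone.
Qed.

Lemma curv_scale_le u s f : (forall g, 0 <= u g) -> 1 <= s ->
  curv u f <= curv (fun g => s * u g) f.
Proof.
move=> u0 s1; apply: ler_sum => e _; apply: lerD.
  by case: ifP => // _; exact: bigon_curvature_scale_le.
by case: ifP => // _; exact: bigon_curvature_scale_le.
Qed.

Lemma curv_scale_lt u s f : (forall g, 0 <= u g) -> 0 < u f -> 1 < s ->
  curv u f < curv (fun g => s * u g) f.
Proof.
move=> u0 uf s1; have [e fe] := incident f.
rewrite /curv (bigD1 e) //= [ltRHS](bigD1 e) //=.
have hlt g1 g2 : g1 = f -> bigon_curvature (Phi e) (u g1) (u g2) <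
    bigon_curvature (Phi e) (s * u g1) (s * u g2).
  by move=> ->; apply: bigon_curvature_scale_lt.
have hle e' g1 g2 : bigon_curvature (Phi e') (u g1) (u g2) <=
    bigon_curvature (Phi e') (s * u g1) (s * u g2).
  by apply: bigon_curvature_scale_le => //; exact: ltW.
apply: ltr_leD; last first.
  by apply: ler_sum => e' _; apply: lerD; case: ifP.
case: fe => fe.
  by apply: ltr_leD; [rewrite fe eqxx; exact: hlt|case: ifP].
by apply: ler_ltD; [case: ifP|rewrite fe eqxx; exact: hlt].
Qed.

Lemma curv_eq0 u f : u f = 0 -> curv u f = 0.
Proof.
move=> uf0; apply: big1 => e _.
by do 2?case: eqP => [->|_]; rewrite ?uf0 ?bigon_curvature0 ?addr0.
Qed.

Lemma curv_gt0 u f : 0 < u f -> 0 < curv u f.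
Proof.
move=> uf0; have [e fe] := incident f.
have h0 e' g1 g2 : g1 = f -> 0 < bigon_curvature (Phi e') (u g1) (u g2).
  by move=> ->; exact: bigon_curvature_gt0.
have h0' e' g1 g2 :
    0 <= (if g1 == f then bigon_curvature (Phi e') (u g1) (u g2) else 0).
  by case: eqP => // g1f; rewrite ltW // h0.
rewrite /curv (bigD1 e) //=; apply: ltr_wpDr.
  by apply: sumr_ge0 => e' _; rewrite addr_ge0.
case: fe => fe.
  by apply: ltr_pwDl => //; rewrite fe eqxx h0.
by apply: ltr_wpDl => //; rewrite fe eqxx h0.
Qed.

Definition curv_bound : R := \sum_(e : E) (pi + pi).

Lemma curv_le_bound u f : (forall g, 0 <= u g) -> curv u f <= curv_bound.
Proof.
move=> u0; apply: ler_sum => e _; apply: lerD.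
  by case: ifP => _; rewrite ?pi_ge0 // bigon_curvature_le_pi.
by case: ifP => _; rewrite ?pi_ge0 // bigon_curvature_le_pi.
Qed.

Lemma curv_cvg (T : Type) (F : set_system T) {FF : Filter F}
    (U : T -> 'I_n -> R) u f :
  (forall g, U t g @[t --> F] --> u g) -> curv (U t) f @[t --> F] --> curv u f.
Proof.
move=> Uu; rewrite /curv; apply: cvg_big => [|e _].
  by move=> p; exact: add_continuous.
apply: cvgD; case: ifP => _; try exact: cvg_cst.
  exact: bigon_curvature_cvg.
exact: bigon_curvature_cvg.
Qed.

Lemma curv_continuous u f (eps : R) : 0 < eps -> exists2 d, 0 < d &
  forall v, (forall g, `|v g - u g| < d) -> `|curv v f - curv u f| < eps.
Proof.
move=> eps0.
have h : curv (fun g => k g 0) f @[k --> (\col_g u g : 'cV[R]_n)] --> curv u f.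
  apply: curv_cvg => g; have := @coord_continuous R n 1 g 0 (\col_g u g).
  by rewrite /continuous_at mxE.
have /cvgr_dist_lt/(_ _ eps0) := h.
move=> /nbhs_ballP[d /= d0 dP].
exists d => // v vu.
have := dP (\col_g v g); rewrite distrC.
have -> : (fun g => (\col_g v g) g 0) = v by apply/funext => g; rewrite mxE.
apply; split => // i j; rewrite !mxE; rewrite /ball /= distrC; exact: vu.
Qed.

Lemma curv_lipschitz (K K' : 'I_n -> R) m f :
  (forall g, `|K g - K' g| <= m) ->
  `|curv (fun g => expR (K g)) f - curv (fun g => expR (K' g)) f|
  <= (\sum_(e : E) ((pi + 4) + (pi + 4))) * m.
Proof.
move=> Km; rewrite /curv -sumrB mulr_suml; apply: le_trans (ler_norm_sum _ _ _) _.
apply: ler_sum => e _; rewrite opprD addrACA mulrDl.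
have m0 : 0 <= m by apply: le_trans (Km f).
have pm : 0 <= (pi + 4) * m by rewrite mulr_ge0 // addr_ge0 // pi_ge0.
apply: le_trans (ler_normD _ _) _; apply: lerD; case: ifP => _.
- exact: bigon_curvature_lipschitz.
- by rewrite subrr normr0.
- exact: bigon_curvature_lipschitz.
- by rewrite subrr normr0.
Qed.

(** At a face where [u / v] attains its maximum [s], supposed larger than 1,
[u] is below [s * v] and touches it, so that
[curv u >= curv (s * v) > curv v] there. *)
Lemma curv_comparison u v : (forall f, 0 <= u f) -> (forall f, 0 <= v f) ->
  (forall f, 0 < u f -> 0 < v f /\ curv u f <= curv v f) -> forall f, u f <= v f.
Proof.
move=> u0 v0 uv f; rewrite leNgt; apply/negP => vuf.
have uf : 0 < u f by exact: le_lt_trans (v0 f) vuf.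
case: (@arg_maxP _ _ _ f (fun g => 0 < u g) (fun g => u g / v g) uf) => g ug gmax.
have [vg uvg] := uv _ ug.
set s := u g / v g in gmax.
have s1 : 1 < s.
  apply: lt_le_trans (gmax f uf); rewrite ltr_pdivlMr ?mul1r //.
  exact: (uv _ uf).1.
have usv h : u h <= s * v h.
  have [uh|] := ltP 0 (u h); last first.
    by move=> /le_trans; apply; rewrite mulr_ge0 // ltW // (lt_trans _ s1).
  have [vh _] := uv _ uh.
  by rewrite -ler_pdivrMr //; exact: gmax.
have := curv_quasi (u0 g) _ usv; rewrite /s divfK ?lt0r_neq0 // => /(_ erefl).
have := curv_scale_lt v0 vg s1; rewrite /s => h1 h2.
by have := lt_le_trans h1 (le_trans h2 uvg); rewrite ltxx.
Qed.

Lemma sum_if_eq A g (x : R) :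
  \sum_(f in A) (if g == f then x else 0) = if g \in A then x else 0.
Proof.
rewrite -big_mkcondr /=; case: ifP => gA.
  rewrite (big_pred1 g) // => f /=.
  by rewrite [g == f]eq_sym; case: eqP => [->|]; rewrite ?gA // andbF.
by apply: big_pred0 => f; case: eqP => [<-|]; rewrite ?gA // andbF.
Qed.

Lemma sum_curv A u : \sum_(f in A) curv u f = \sum_e
  ((if f1 e \in A then bigon_curvature (Phi e) (u (f1 e)) (u (f2 e)) else 0) +
   (if f2 e \in A then bigon_curvature (Phi e) (u (f2 e)) (u (f1 e)) else 0)).
Proof.
rewrite /curv exchange_big /=; apply: eq_bigr => e _.
by rewrite big_split /= !sum_if_eq.
Qed.

(** Quantitative form of the blow-up: on a set [A] of faces with curvatures at
least [tan b], the other ones being bounded by [B], an edge with both sides in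
[A] contributes at least [2 * sin b * Phi e] by [acot_add], and an edge with
one side in [A] nearly as much.  Curvatures are measured by [tan b] so that the
limit [b = pi / 2] is taken in a continuous function. *)
Lemma sum_curv_ge A u (B b : R) : 0 < b < pi / 2 -> 0 <= B ->
  (forall f, 0 <= u f) ->
  (forall f, f \in A -> tan b <= u f) -> (forall f, f \notin A -> u f <= B) ->
  2 * sin b * \sum_(e | (f1 e \in A) || (f2 e \in A))
     acot ((B * cos b / sin b + cos (Phi e)) / sin (Phi e))
  <= \sum_(f in A) curv u f.
Proof.
move=> /andP[b0 bpi] B0 u0 uA uB; rewrite sum_curv mulr_sumr big_mkcond /=.
have pi0 := @pi_gt0 R.
have sb : 0 < sin b by apply: sin_gt0_pi; lra.
have cb : 0 < cos b by apply: cos_gt0_pihalf; lra.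
have tb : 0 < tan b by rewrite divr_gt0.
have atb : atan (tan b) = b by rewrite tanK // in_itv /=; apply/andP; split; lra.
apply: ler_sum => e _; have /andP[p0 p1] := PhiP e.
have sp : 0 < sin (Phi e) by apply: sin_gt0_pi; lra.
have cp : 0 < cos (Phi e) by apply: cos_gt0_pihalf; lra.
pose h q : R := acot ((q + cos (Phi e)) / sin (Phi e)).
have hle q q' : q <= q' -> h q' <= h q.
  by move=> qq; apply: le_acot; rewrite ler_pM2r ?invr_gt0 // lerD2r.
have one f g : f \in A ->
    2 * sin b * h (u g / u f) <= bigon_curvature (Phi e) (u f) (u g).
  move=> fA; have uf : 0 < u f by apply: lt_le_trans (uA _ fA).
  apply: le_trans (bigon_curvature_ge (PhiP e) uf (u0 g)).
  apply: ler_wpM2r; first exact/ltW/acot_gt0.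
  rewrite ler_pM2l // -[in leLHS]atb.
  by apply: le_sin_atan; exact: uA.
have two f g : f \in A -> g \notin A ->
    2 * sin b * h (B * cos b / sin b) <= bigon_curvature (Phi e) (u f) (u g).
  move=> fA gA; have uf : 0 < u f by apply: lt_le_trans (uA _ fA).
  apply: le_trans (one _ g fA); rewrite ler_pM2l ?mulr_gt0 //; apply: hle.
  have -> : B * cos b / sin b = B / tan b.
    by rewrite /tan invf_div mulrA.
  apply: ler_pM => //; rewrite ?invr_ge0 ?uB //.
  by rewrite lef_pV2 ?posrE // uA.
have [f1A|f1A] := boolP (f1 e \in A); have [f2A|f2A] := boolP (f2 e \in A) => /=.
- have uf1 : 0 < u (f1 e) by apply: lt_le_trans (uA _ f1A).
  have uf2 : 0 < u (f2 e) by apply: lt_le_trans (uA _ f2A).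
  apply: le_trans (lerD (one _ (f2 e) f1A) (one _ (f1 e) f2A)).
  rewrite -mulrDr ler_pM2l ?mulr_gt0 //.
  have := @acot_add R (Phi e) (PhiP e) (u (f2 e) / u (f1 e)) (divr_gt0 uf2 uf1).
  rewrite invf_div -/(h _) -/(h _) => ->.
  apply: (@le_trans _ _ (h 0)).
    by apply: hle; rewrite divr_ge0 ?mulr_ge0 // ltW.
  by rewrite /h add0r cotK // p0 /=; lra.
- by rewrite addr0; exact: two.
- by rewrite add0r; exact: two.
- by rewrite addr0.
Qed.

Section Perron.
Variable lam : 'I_n -> R.
Hypothesis lam_gt0 : forall f, 0 < lam f.
Hypothesis lam_lt : forall A, A != finset.set0 ->
  \sum_(f in A) lam f < 2 * \sum_(e | (f1 e \in A) || (f2 e \in A)) Phi e.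

Definition subsolution : set ('I_n -> R) :=
  [set u | (forall f, 0 <= u f) /\ forall f, curv u f <= lam f].

Lemma subsolution0 : subsolution (fun=> 0).
Proof. by split => // f; rewrite curv_eq0 // ltW. Qed.

Lemma subsolution_max u v : subsolution u -> subsolution v ->
  subsolution (fun f => Num.max (u f) (v f)).
Proof.
move=> [u0 ul] [v0 vl]; split => f; first by rewrite le_max u0.
have [uv|vu] := leP (u f) (v f).
  apply: le_trans (vl f); apply: curv_quasi => //; first exact/esym/max_idPr.
  by move=> g; rewrite le_max lexx orbT.
apply: le_trans (ul f); apply: curv_quasi => //; first exact/esym/max_idPl/ltW.
by move=> g; rewrite le_max lexx.
Qed.

(** Subsolutions are stable under maximum, so finitely many lower bounds that
can be reached separately can be reached together. *)
Lemma subsolution_large (c : 'I_n -> R) A :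
  (forall f, f \in A -> exists2 u, subsolution u & c f < u f) ->
  exists2 u, subsolution u & forall f, f \in A -> c f < u f.
Proof.
move=> cA.
suff [u su uP] : exists2 u, subsolution u & forall f, f \in enum A -> c f < u f.
  by exists u => // f fA; apply: uP; rewrite mem_enum.
have {cA} : forall f, f \in enum A -> exists2 u, subsolution u & c f < u f.
  by move=> f; rewrite mem_enum; exact: cA.
elim: (enum A) => [_|f s IH cA].
  by exists (fun=> 0) => //; exact: subsolution0.
have [|u su us] := IH; first by move=> g gs; apply: cA; rewrite in_cons gs orbT.
have [v sv vf] := cA f (mem_head _ _).
exists (fun g => Num.max (u g) (v g)); first exact: subsolution_max.
move=> g; rewrite in_cons lt_max => /orP[/eqP->|/us ->//].
by rewrite vf orbT.
Qed.

(** Otherwise let [A] be the set of the faces where subsolutions are unbounded.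
By [sum_curv_ge] the sum of [lam] over [A] would be at least twice the sum of
the angles of the edges incident to [A]. *)
Lemma subsolution_bounded : exists B, forall u, subsolution u -> forall f, u f <= B.
Proof.
pose unb f := forall N, exists2 u, subsolution u & N < u f.
pose A : {set 'I_n} := [set f | `[< unb f >]]%SET.
(* A common bound outside of [A]. *)
have [B B0 BP] : exists2 B, 0 <= B &
    forall u, subsolution u -> forall f, f \notin A -> u f <= B.
  have : forall f, exists N, f \notin A -> forall u, subsolution u -> u f <= N.
    move=> f; have [fA|] := boolP (f \in A); first by exists 0.
    rewrite inE => /asboolPn /existsNP[N NP]; exists N => _ u su.
    by rewrite leNgt; apply/negP => Nu; apply: NP; exists u.
  move=> /choice[N NP]; exists (\sum_f `|N f|); first by apply: sumr_ge0.
  move=> u su f fA; apply: le_trans (NP f fA u su) _.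
  apply: le_trans (ler_norm _) _; rewrite (bigD1 f) //= lerDl.
  exact: sumr_ge0.
have [A0|/lam_lt ltA] := eqVneq A finset.set0.
  by exists B => u su f; apply: BP => //; rewrite A0 inE.
exfalso.
pose G (b : R) := 2 * sin b * \sum_(e | (f1 e \in A) || (f2 e \in A))
     acot ((B * cos b / sin b + cos (Phi e)) / sin (Phi e)).
have Gle b : 0 < b < pi / 2 -> G b <= \sum_(f in A) lam f.
  move=> bP.
  have [|u su uA] := @subsolution_large (fun=> tan b) A.
    by move=> f; rewrite inE => /asboolP.
  apply: (@le_trans _ _ (\sum_(f in A) curv u f)).
    apply: sum_curv_ge => //; first exact: su.1.
      by move=> f fA; rewrite ltW // uA.
    by move=> f fA; exact: BP.
  by apply: ler_sum => f _; exact: su.2.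
have Gpi : G (pi / 2) = 2 * \sum_(e | (f1 e \in A) || (f2 e \in A)) Phi e.
  rewrite /G sin_pihalf cos_pihalf mulr1; congr (_ * _).
  apply: eq_bigr => e _; rewrite mulr0 mul0r add0r cotK //.
  by have /andP[-> /=] := PhiP e; have := @pi_gt0 R; lra.
have Gc : G b @[b --> pi / 2] --> G (pi / 2).
  have s2 : sin b @[b --> pi / 2] --> sin (pi / 2 : R) by exact: continuous_sin.
  have c2 : cos b @[b --> pi / 2] --> cos (pi / 2 : R) by exact: continuous_cos.
  apply: cvgM; first by apply: cvgM => //; exact: cvg_cst.
  apply: cvg_big => [|e _]; first by move=> p; exact: add_continuous.
  apply: cvgB; first exact: cvg_cst.
  suff : (B * cos b / sin b + cos (Phi e)) / sin (Phi e) @[b --> pi / 2] -->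
     (B * cos (pi / 2) / sin (pi / 2) + cos (Phi e)) / sin (Phi e).
    by move=> /cvg_comp; apply; exact: continuous_atan.
  apply: cvgM; last exact: cvg_cst.
  apply: cvgD; last exact: cvg_cst.
  apply: cvgM; first by apply: cvgM => //; exact: cvg_cst.
  by apply: cvgV => //; rewrite sin_pihalf oner_neq0.
have Gl : G b @[b --> (pi / 2)^'-] --> G (pi / 2) by exact: cvg_at_left_filter.
rewrite -Gpi in ltA.
have pih : 0 < pi / 2 :> R by rewrite divr_gt0 // pi_gt0.
near (pi / 2 : R)^'- => b.
have : G b <= \sum_(f in A) lam f.
  apply: Gle; apply/andP; split; first by near: b; exact: nbhs_left_gt.
  by near: b; exact: nbhs_left_lt.
apply/negP; rewrite -ltNge; near: b.
exact: cvgr_gt Gl _ ltA.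
Unshelve. all: by end_near. Qed.

(** Perron method.  The supremum of the subsolutions is a subsolution by
continuity; if it were strict at some face, raising it slightly at this face
would give a larger subsolution, since this lowers the curvature of the other
faces. *)
Lemma curv_surjective : exists u, forall f, 0 < u f /\ curv u f = lam f.
Proof.
have [B BP] := subsolution_bounded.
pose Sf f := [set u f | u in subsolution].
have hs f : has_sup (Sf f).
  split; first by exists 0, (fun=> 0) => //; exact: subsolution0.
  by exists B => _ [u su <-]; exact: BP.
pose w f := sup (Sf f).
have le_w u f : subsolution u -> u f <= w f.
  by move=> su; apply: (ub_le_sup (hs f).2); exists u.
have w0 f : 0 <= w f by exact: (le_w (fun=> 0) f subsolution0).
have wsub f : curv w f <= lam f.
  rewrite leNgt; apply/negP; rewrite -subr_gt0 => /(curv_continuous w f)[d d0 dP].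
  have [|u su uP] := @subsolution_large (fun g => w g - d) [set: 'I_n]%SET.
    move=> g _; have [_ [u su <-] ug] := sup_adherent d0 (hs g).
    by exists u.
  have uf := su.2 f.
  have /dP : forall g, `|u g - w g| < d.
    move=> g; have := uP g (finset.in_setT g); have := le_w _ g su.
    by move=> ? ?; rewrite ler0_norm; lra.
  by rewrite ltr_norml; lra.
have wE f : curv w f = lam f.
  apply/eqP; rewrite eq_le wsub leNgt; apply/negP.
  rewrite -subr_gt0 => /(curv_continuous w f)[d d0 dP].
  pose v g := if g == f then w f + d / 2 else w g.
  have wv g : w g <= v g.
    by rewrite /v; case: eqP => // ->; rewrite lerDl divr_ge0 // ltW.
  have sv : subsolution v.
    split => g; first by exact: le_trans (w0 g) (wv g).
    have [->|gf] := eqVneq g f.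
      have /dP : forall g, `|v g - w g| < d.
        move=> h; rewrite /v; case: eqP => [->|_]; last by rewrite subrr normr0.
        by rewrite addrAC subrr add0r ger0_norm; lra.
      by rewrite ltr_norml; lra.
    apply: le_trans (wsub g); apply: curv_quasi => //.
    by rewrite /v (negbTE gf).
  have := le_w _ f sv; rewrite /v eqxx; lra.
exists w => f; split => //; rewrite lt_neqAle w0 andbT eq_sym.
by apply/eqP => /curv_eq0; rewrite wE => l0; have := lam_gt0 f; rewrite l0 ltxx.
Qed.

End Perron.

(** The solutions for [lam + eps] increase with [eps], by comparison; their
infimum solves the problem for [lam].  They are kept in the conclusion: they
are the strict supersolutions that drive the flow down to the limit. *)
Lemma curv_degenerate lam : (forall f, 0 <= lam f) ->
  (forall A, A != finset.set0 ->
    \sum_(f in A) lam f < 2 * \sum_(e | (f1 e \in A) || (f2 e \in A)) Phi e) ->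
  exists w, [/\ forall f, 0 <= w f, forall f, curv w f = lam f &
    forall d, 0 < d -> exists u eps, 0 < eps /\ forall f,
      [/\ 0 < u f, curv u f = lam f + eps, w f <= u f & u f < w f + d]].
Proof.
move=> lam0 lam_lt.
have [e0 e00 e0P] : exists2 e0 : R, 0 < e0 & forall e, 0 < e <= e0 ->
    exists u, forall f, 0 < u f /\ curv u f = lam f + e.
  have : \forall e \near (0 : R)^'+, forall A : {set 'I_n}, A != finset.set0 ->
    \sum_(f in A) (lam f + e) < 2 * \sum_(e | (f1 e \in A) || (f2 e \in A)) Phi e.
    apply: filter_forall => A.
    have [->|/lam_lt ltA] := eqVneq A finset.set0; first by near=> e.
    have h : \sum_(f in A) (lam f + e) @[e --> 0^'+] --> \sum_(f in A) (lam f + 0).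
      apply: cvg_at_right_filter.
      apply: cvg_big => [|f _]; first by move=> p; exact: add_continuous.
      by apply: cvgD; [exact: cvg_cst|exact: cvg_id].
    move: ltA; under eq_bigr do rewrite -[lam _]addr0; move=> ltA.
    near=> e => _; near: e; exact: cvgr_lt h _ ltA.
  move=> /nbhs_ballP[d /= d0 dP].
  exists (d / 2); first by rewrite divr_gt0.
  move=> e /andP[ep ed]; apply: curv_surjective => [f|]; first by rewrite ltr_wpDl.
  apply: dP => //; rewrite /ball /= sub0r normrN gtr0_norm //; lra.
have /choice[U UP] : forall e, exists u, 0 < e <= e0 ->
    forall f, 0 < u f /\ curv u f = lam f + e.
  move=> e; have [/e0P[u uP]|] := boolP (0 < e <= e0); first by exists u.
  by exists (fun=> 0).
(* [U e] is the solution for [lam + e]. *)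
have Ule e e' f : 0 < e -> e <= e' -> e' <= e0 -> U e f <= U e' f.
  move=> ep ee ee0.
  have u1 := UP e; have u2 := UP e'.
  rewrite ep (le_trans ee ee0) in u1; rewrite (lt_le_trans ep ee) ee0 in u2.
  apply: curv_comparison => g.
  - exact/ltW/(u1 isT g).1.
  - exact/ltW/(u2 isT g).1.
  - split; first exact: (u2 isT g).1.
    by rewrite (u1 isT g).2 (u2 isT g).2 lerD2l.
pose Sf f := [set U e f | e in [set e | 0 < e <= e0]].
have hi f : has_inf (Sf f).
  split; first by exists (U e0 f), e0 => //=; rewrite e00 lexx.
  by exists 0 => _ [e /= eP <-]; exact/ltW/(UP e eP f).1.
pose w f := inf (Sf f).
have w_le e f : 0 < e <= e0 -> w f <= U e f.
  by move=> eP; apply: (ge_inf (hi f).2); exists e.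
have w0 f : 0 <= w f.
  by apply: lb_le_inf (hi f).1 _ => _ [e /= eP <-]; exact/ltW/(UP e eP f).1.
have approx d : 0 < d ->
    exists2 e, 0 < e <= Num.min d e0 & forall f, U e f < w f + d.
  move=> d0.
  suff [e eP eU] : exists2 e, 0 < e <= Num.min d e0 &
      forall f, f \in enum 'I_n -> U e f < w f + d.
    by exists e => // f; apply: eU; rewrite mem_enum.
  elim: (enum 'I_n) => [|f s [e eP IH]].
    by exists (Num.min d e0) => //; rewrite lt_min d0 e00 lexx.
  have [_ [e' /= /andP[e'0 e'P] <-] e'f] := inf_adherent d0 (hi f).
  move: eP; rewrite le_min => /and3P[ep ed ee0].
  exists (Num.min e e').
    by rewrite lt_min ep e'0 le_min !ge_min ed ee0.
  have m0 : 0 < Num.min e e' by rewrite lt_min ep e'0.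
  move=> g; rewrite in_cons => /orP[/eqP->|/IH].
    by apply: le_lt_trans e'f; apply: Ule => //; rewrite ge_min lexx orbT.
  by apply: le_lt_trans; apply: Ule => //; rewrite ge_min lexx.
exists w; split => // [f|d d0]; last first.
  have [e] := approx d d0; rewrite le_min => /and3P[ep ed ee0] eU.
  have eP : 0 < e <= e0 by rewrite ep.
  exists (U e), e; split => // f; have [? ?] := UP e eP f.
  by split => //; exact: w_le.
apply/eqP; rewrite -subr_eq0 -normr_le0; apply/ler_addgt0Pl => eta eta0.
have eta20 : 0 < eta / 2 by rewrite divr_gt0.
have [d d0 dP] := curv_continuous w f eta20.
have [|e] := approx (Num.min d (eta / 2)); first by rewrite lt_min d0.
rewrite !le_min => /andP[ep /andP[/andP[_ ee2] ee0]] eU.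
have eP : 0 < e <= e0 by rewrite ep.
have /dP : forall g, `|U e g - w g| < d.
  move=> g; have h := w_le e g eP; rewrite ger0_norm ?subr_ge0 //.
  by rewrite ltrBlDl (lt_le_trans (eU g)) // lerD2l ge_min lexx.
rewrite (UP e eP f).2 addr0 ltr_norml ler_norml; lra.
Unshelve. all: by end_near. Qed.

End Network.

(** * Maximum principle and global solutions of Lipschitz systems *)

Section FirstTouch.
Variables (R : realType) (I : finType) (g dg : I -> R -> R).
Hypothesis g_right0 : forall i, g i t @[t --> 0^'+] --> g i 0.
Hypothesis g_derive : forall i (t : R), 0 < t -> is_derive t 1 (g i) (dg i t).
Hypothesis g0 : forall i, g i 0 < 0.
Hypothesis touch : forall i (t : R), 0 < t -> (forall j, g j t <= 0) -> g i t = 0 ->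
  dg i t < 0.

(** Maximum principle for a finite family: at the first time when one of the
functions vanishes, it would have been negative before and hence have a
nonnegative derivative.  Only right continuity is assumed at 0, as for the
solutions of the flow. *)
Lemma first_touch i t : 0 <= t -> g i t < 0.
Proof.
move=> t0; rewrite ltNge; apply/negP => git.
pose S := [set s | 0 <= s /\ exists j, 0 <= g j s].
have [d d0 dP] : exists2 d, 0 < d & forall s, 0 <= s < d -> forall j, g j s < 0.
  have : \forall s \near 0^'+, forall j, g j s < 0.
    by apply: filter_forall => j; exact: cvgr_lt (g_right0 (i := j)) _ (g0 j).
  move=> /nbhs_ballP[d /= d0 dP]; exists d => // s /andP[].
  rewrite le_eqVlt => /predU1P[<- //|s0 sd]; apply: dP => //.
  by rewrite /ball /= sub0r normrN gtr0_norm.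
(* [S] stays away from 0 because of the strict initial inequalities. *)
have Slb : lbound S d.
  move=> s [s0 [j gjs]]; rewrite leNgt; apply/negP => sd.
  by have := dP s; rewrite s0 sd => /(_ isT j); rewrite ltNge gjs.
have hS : has_inf S by split; [exists t; split=> //; exists i|exists d].
set s := inf S.
have s0 : 0 < s by apply: lt_le_trans d0 _; exact: lb_le_inf hS.1 Slb.
have before r : 0 <= r < s -> forall j, g j r < 0.
  move=> /andP[r0 rs] j; rewrite ltNge; apply/negP => gjr.
  have : s <= r by apply: (ge_inf hS.2); split=> //; exists j.
  by rewrite leNgt rs.
have gc j : g j r @[r --> s] --> g j s.
  exact: is_derive_continuous (g_derive j s0).
have gle j : g j s <= 0.
  rewrite leNgt; apply/negP => gjs.
  have h : g j r @[r --> s^'-] --> g j s by exact: cvg_at_left_filter (gc j).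
  near s^'- => r.
  have : 0 < g j r by near: r; exact: cvgr_gt h _ gjs.
  rewrite ltNge ltW // before //; apply/andP; split.
    by near: r; exact: nbhs_left_ge.
  by near: r; exact: nbhs_left_lt.
have [j gjs] : exists j, 0 <= g j s.
  apply: contrapT => /forallNP gs.
  have : \forall r \near s, forall j, g j r < 0.
    apply: (@filter_forall R I (fun j r => g j r < 0) (nbhs s)) => j.
    have gjs : g j s < 0 by rewrite ltNge; apply/negP; exact: gs.
    exact: cvgr_lt (gc j) _ gjs.
  move=> /nbhs_ballP[e /= e0 eP].
  have [r rS rs] := inf_adherent e0 hS.
  have sr : s <= r by apply: (ge_inf hS.2).
  case: rS => r0 [j]; apply/negP; rewrite -ltNge; apply: eP.
  rewrite /ball /= distrC ger0_norm ?subr_ge0 //; rewrite -/s in rs; lra.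
have gjs0 : g j s = 0 by apply/eqP; rewrite eq_le gle gjs.
have dneg := touch s0 gle gjs0.
have [dj djE] := g_derive j s0.
have : h^-1 *: ((g j \o shift s) (h *: 1) - g j s) @[h --> 0^'] --> dg j s.
  by rewrite -djE.
move=> /(cvgr_lt _)/(_ _ dneg).
rewrite near_withinE => /nbhs_ballP[e /= e0 eP].
(* A time just before [s], where the difference quotient is still negative. *)
pose m := Num.min (e / 2) (s / 2).
have m0 : 0 < m by rewrite lt_min !divr_gt0.
have me : m <= e / 2 by rewrite ge_min lexx.
have ms : m <= s / 2 by rewrite ge_min lexx orbT.
have /(_ _ _) := eP (- m); rewrite /ball /= sub0r opprK gtr0_norm //.
have me' : m < e by lra.
move=> /(_ me'); rewrite oppr_eq0 lt0r_neq0 // => /(_ isT).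
rewrite gjs0 subr0 /GRing.scale /= mulr1 invrN mulNr oppr_lt0.
rewrite pmulr_rgt0 ?invr_gt0 // ltNge ltW // before //.
by apply/andP; split; lra.
Unshelve. all: by end_near. Qed.

End FirstTouch.

Section Picard.
Variable R : realType.

(** Integrating from [-1] makes the derivative at 0 two-sided. *)
Lemma antiderivative (h : R -> R) (y0 : R) : continuous h ->
  exists F : R -> R, F 0 = y0 /\ forall t : R, 0 <= t -> is_derive t 1 F (h t).
Proof.
move=> hc; pose mu := @lebesgue_measure R.
pose P x : R := (\int[mu]_(t in [set` `[-1, x]]) (h t))%R.
exists (fun x => P x - P 0 + y0); split; first by rewrite subrr add0r.
move=> t t0.
have hi : mu.-integrable `[-1, t + 1] (EFin \o h).
  apply: continuous_compact_integrable; first exact: segment_compact.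
  exact: continuous_subspaceT.
have tt : t < t + 1 by rewrite ltrDl.
have t1 : -1 < t by apply: lt_le_trans t0; rewrite ltrN10.
have [dP dPE] : derivable P t 1 /\ derive1 P t = h t.
  exact: continuous_FTC1_closed tt hi t1 (hc t).
have h1 : is_derive t 1 P (h t).
  by rewrite derive1E in dPE; exact: DeriveDef dP dPE.
have -> : (fun x => P x - P 0 + y0) = P + cst (- P 0 + y0).
  by apply/funext => x; rewrite -addrA.
by apply: is_derive_eq; rewrite addr0.
Qed.

Lemma is_derive_nondecr (f df : R -> R) t : 0 <= t ->
  (forall s : R, 0 <= s -> is_derive s 1 f (df s)) ->
  (forall s, 0 <= s -> 0 <= df s) -> f 0 <= f t.
Proof.
rewrite le_eqVlt => /predU1P[<- //|t0] fdf df0.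
have cf : {within `[0, t], continuous f}.
  apply: continuous_in_subspaceT => x; rewrite inE /= in_itv /= => /andP[x0 _].
  exact: is_derive_continuous (fdf x x0).
have fdf' (x : R) : x \in `]0, t[ -> is_derive x 1 f (df x).
  by rewrite in_itv /= => /andP[x0 _]; apply/fdf/ltW.
have [c ct E] := MVT t0 fdf' cf.
rewrite -subr_ge0 E subr0; apply: mulr_ge0; last exact: ltW.
by apply: df0; move: ct; rewrite in_itv /= => /andP[/ltW].
Qed.

Lemma is_derive_expR_scaled (a t : R) :
  is_derive t 1 (fun t => expR (a * t)) (a * expR (a * t)).
Proof.
have ha : is_derive t 1 (fun t => a * t) a.
  have -> : (fun t => a * t) = a *: (id : R -> R) by [].
  by apply: is_derive_eq; rewrite /GRing.scale /= mulr1.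
have := @is_derive1_comp R expR (fun t => a * t) t _ _ (is_derive_expR _) ha.
by move=> H; apply: (is_derive_eq H); rewrite mulrC.
Qed.

(** Integrated form of the estimate of Picard iteration: the right-hand side
is the derivative of the bound. *)
Lemma exp_growth (z dz : R -> R) (a B t : R) : 0 <= t -> 0 <= B -> z 0 = 0 ->
  (forall s : R, 0 <= s -> is_derive s 1 z (dz s)) ->
  (forall s, 0 <= s -> `|dz s| <= a * (B * expR (a * s))) ->
  `|z t| <= B * expR (a * t).
Proof.
move=> t0 B0 z0 zdz dzB.
have he (s : R) : is_derive s 1 (B *: (fun t => expR (a * t)))
    (B *: (a * expR (a * s))).
  by have := is_derive_expR_scaled a s; move=> H; exact: is_deriveZ.
have key (w dw : R -> R) : w 0 = 0 ->
    (forall s : R, 0 <= s -> is_derive s 1 w (dw s)) ->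
    (forall s, 0 <= s -> - dw s <= a * (B * expR (a * s))) ->
    - w t <= B * expR (a * t).
  move=> w0 wdw dwB.
  have hd (s : R) : 0 <= s -> is_derive s 1 (B *: (fun t => expR (a * t)) + w)
      (B *: (a * expR (a * s)) + dw s).
    by move=> s0; exact: (is_deriveD (he s) (wdw s s0)).
  have h : (forall s, 0 <= s -> 0 <= B *: (a * expR (a * s)) + dw s) ->
      B * expR (a * 0) + w 0 <= B * expR (a * t) + w t.
    exact: is_derive_nondecr t0 hd.
  rewrite w0 mulr0 expR0 mulr1 addr0 in h.
  have : B <= B * expR (a * t) + w t.
    by apply: h => s s0; have := dwB s s0; rewrite mulrCA /GRing.scale /=; lra.
  lra.
rewrite ler_norml lerNl; apply/andP; split.
  apply: (key z dz) => // s s0; apply: le_trans (dzB s s0).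
  by rewrite -normrN ler_norm.
rewrite -[z t]opprK.
apply: (key (fun s => - z s) (fun s => - dz s)) => [|s s0|s s0].
- by rewrite z0 oppr0.
- exact: (is_deriveN (zdz s s0)).
- by rewrite opprK; apply: le_trans (dzB s s0); rewrite ler_norm.
Qed.

(** The limit is the supremum of the nondecreasing sequence
[x m - 2 * B / 2 ^+ m]. *)
Lemma geometric_limit (x : nat -> R) (B : R) : 0 <= B ->
  (forall m, `|x m.+1 - x m| <= B / 2 ^+ m) ->
  exists l, forall m, `|l - x m| <= 2 * B / 2 ^+ m.
Proof.
move=> B0 xB.
(* The intervals from [lo m] to [hi m] are nested. *)
pose lo m := x m - 2 * B / 2 ^+ m; pose hi m := x m + 2 * B / 2 ^+ m.
have half m : 2 * B / 2 ^+ m.+1 = B / 2 ^+ m.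
  by rewrite exprS invfM; field; rewrite expf_neq0.
have full m : 2 * B / 2 ^+ m = B / 2 ^+ m + B / 2 ^+ m.
  by rewrite -mulrDl; congr (_ / _); ring.
have los m p : (m <= p)%N -> lo m <= lo p.
  move=> /subnKC <-; elim: (p - m)%N => [|q IH]; first by rewrite addn0.
  apply: (le_trans IH); rewrite addnS /lo half full.
  by have := xB (m + q)%N; rewrite ler_norml => /andP[]; lra.
have his m p : (m <= p)%N -> hi p <= hi m.
  move=> /subnKC <-; elim: (p - m)%N => [|q IH]; first by rewrite addn0.
  apply: le_trans IH; rewrite addnS /hi half full.
  by have := xB (m + q)%N; rewrite ler_norml => /andP[]; lra.
have B2 m : 0 <= 2 * B / 2 ^+ m by rewrite divr_ge0 ?mulr_ge0 // exprn_ge0.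
have lohi m p : lo m <= hi p.
  apply: le_trans (los _ _ (leq_maxl m p)) _.
  apply: le_trans (his _ _ (leq_maxr m p)); rewrite /lo /hi.
  by have := B2 (maxn m p); lra.
have hs : has_sup (range lo).
  by split; [exists (lo 0%N), 0%N|exists (hi 0%N) => _ [m _ <-]].
exists (sup (range lo)) => m.
have h1 : lo m <= sup (range lo) by apply: (ub_le_sup hs.2); exists m.
have h2 : sup (range lo) <= hi m by apply: ge_sup hs.1 _ => _ [p _ <-].
by rewrite ler_norml; move: h1 h2; rewrite /lo /hi; lra.
Qed.

Variables (n : nat) (G : ('I_n -> R) -> 'I_n -> R) (C : R).
Hypothesis C_gt0 : 0 < C.
Hypothesis G_lip : forall K K' (m : R) f, (forall g, `|K g - K' g| <= m) ->
  `|G K f - G K' f| <= C * m.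

Lemma lipschitz_cvg (T : Type) (F : set_system T) {FF : Filter F}
    (U : T -> 'I_n -> R) u f :
  (forall g, U t g @[t --> F] --> u g) -> G (U t) f @[t --> F] --> G u f.
Proof.
move=> Uu; apply/cvgrPdist_le => e e0.
have : \forall t \near F, forall g, `|u g - U t g| <= e / C.
  apply: filter_forall => g; have /cvgrPdist_le := Uu g; apply.
  by rewrite divr_gt0.
apply: filterS => t /(@G_lip _ _ _ f).
by rewrite mulrC divfK // lt0r_neq0.
Qed.

Lemma geometric_small (B e : R) : 0 < e -> exists m, B / 2 ^+ m < e.
Proof.
move=> e0; have [B0|B0] := lerP B 0.
  by exists 0%N; rewrite expr0 divr1; exact: le_lt_trans e0.
have eB : 0 < e / B by rewrite divr_gt0.
have [N _ /(_ N (leqnn N))] := near_infty_natSinv_expn_lt (PosNum eB).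
by rewrite /= => h; exists N; move: h; rewrite div1r ltr_pdivlMr // mulrC.
Qed.

(** Picard iteration.  With the weight [expR (2 * C * t)] the integral operator
contracts distances by 1/2 on the whole half-line, so no continuation argument
is needed. *)
Theorem global_solution (y0 : 'I_n -> R) : exists y : R -> 'I_n -> R,
  (forall f, y 0 f = y0 f) /\
  forall (t : R) f, 0 <= t -> is_derive t 1 (fun s => y s f) (G (y t) f).
Proof.
(* The absolute value extends a function on the half-line to the whole line,
   so that continuity at 0 is the ordinary one. *)
pose cont (y : R -> 'I_n -> R) := forall f, continuous (fun s : R => y `|s| f).
have /choice[step stepP] : forall y, exists z : R -> 'I_n -> R, cont y ->
    (forall f, z 0 f = y0 f) /\
    forall (t : R) f, 0 <= t -> is_derive t 1 (fun s => z s f) (G (y t) f).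
  move=> y; have [cy|] := pselect (cont y); last by exists y.
  have /choice[z zP] : forall f, exists F : R -> R, F 0 = y0 f /\
      forall t : R, 0 <= t -> is_derive t 1 F (G (y `|t|) f).
    move=> f; apply: antiderivative => t.
    by apply: lipschitz_cvg => g; exact: cy.
  exists (fun t f => z f t) => _; split => [f|t f t0]; first exact: (zP f).1.
  by have := (zP f).2 t t0; rewrite ger0_norm.
have step_cont y : cont y -> cont (step y).
  move=> cy f t.
  have := is_derive_continuous ((stepP y cy).2 `|t| f (normr_ge0 t)).
  by move=> h; exact: (cvg_comp _ _ (@norm_continuous R R^o t) h).
pose Y m := iter m step (fun=> y0).
have Yc m : cont (Y m).
  elim: m => [|m IH]; last exact: step_cont.
  by move=> f t; exact: cvg_cst.
have Y0 m f : Y m 0 f = y0 f.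
  by case: m => // m; exact: (stepP _ (Yc m)).1.
have YS m (t : R) f : 0 <= t -> is_derive t 1 (fun s => Y m.+1 s f) (G (Y m t) f).
  by move=> t0; exact: (stepP _ (Yc m)).2.
have diff_bound (z w : R -> 'I_n -> R) (dz dw : R -> 'I_n -> R) B :
    0 <= B -> (forall f, z 0 f = w 0 f) ->
    (forall (t : R) f, 0 <= t -> is_derive t 1 (fun s => z s f) (dz t f)) ->
    (forall (t : R) f, 0 <= t -> is_derive t 1 (fun s => w s f) (dw t f)) ->
    (forall t f, 0 <= t -> `|dz t f - dw t f| <= 2 * C * (B * expR (2 * C * t))) ->
    forall t f, 0 <= t -> `|z t f - w t f| <= B * expR (2 * C * t).
  move=> B0 zw0 zd wd dB t f t0.
  apply: (@exp_growth (fun s => z s f - w s f) (fun s => dz s f - dw s f)) => //.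
  - by rewrite zw0 subrr.
  - by move=> s s0; exact: (is_deriveB (zd s f s0) (wd s f s0)).
  - by move=> s; exact: dB.
(* This value of [D] makes the estimate hold for the first increment. *)
pose D := (\sum_f `|G y0 f|) / (2 * C).
have D0 : 0 <= D by rewrite divr_ge0 ?sumr_ge0 // mulr_ge0 // ltW.
have E1 t : 0 <= t -> 1 <= expR (2 * C * t).
  by move=> t0; rewrite -expR0 ler_expR !mulr_ge0 // ltW.
have two (m : nat) : 0 < 2 ^+ m :> R by exact: exprn_gt0.
have Ydiff m : forall t f, 0 <= t ->
    `|Y m.+1 t f - Y m t f| <= D / 2 ^+ m * expR (2 * C * t).
  elim: m => [|m IH].
    have D1 : 0 <= D / 2 ^+ 0 by rewrite expr0 divr1.
    apply: (diff_bound (Y 1%N) (Y 0%N) (fun t => G (Y 0%N t)) (fun _ _ => 0) _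
      D1 (Y0 1%N) (YS 0%N) (fun t f _ => is_derive_cst (y0 f) t 1)).
    move=> t f t0; rewrite subr0 expr0 divr1 mulrA mulrC.
    rewrite [2 * C * D]mulrC divfK; last by rewrite mulf_neq0 // lt0r_neq0.
    have h : `|G y0 f| <= \sum_f `|G y0 f|.
      by rewrite (bigD1 f) //= lerDl sumr_ge0.
    apply: (le_trans h); rewrite ler_peMl ?E1 //; exact: sumr_ge0.
  have D1 : 0 <= D / 2 ^+ m.+1 by rewrite divr_ge0 // ltW.
  have Y01 f : Y m.+2 0 f = Y m.+1 0 f by rewrite !Y0.
  apply: (diff_bound (Y m.+2) (Y m.+1) (fun t => G (Y m.+1 t))
    (fun t => G (Y m t)) _ D1 Y01 (YS m.+1) (YS m)).
  move=> t f t0; apply: le_trans (@G_lip _ _ _ f (fun g => IH t g t0)) _.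
  rewrite le_eqVlt; apply/orP; left; apply/eqP.
  by rewrite exprS; field; rewrite lt0r_neq0.
have /choice[y' y'P] : forall tf : R * 'I_n, exists l, forall m, 0 <= tf.1 ->
    `|l - Y m tf.1 tf.2| <= 2 * (D * expR (2 * C * tf.1)) / 2 ^+ m.
  move=> [t f] /=; have [t0|t0] := lerP 0 t; last by exists 0.
  have [|m|l lP] := @geometric_limit (fun m => Y m t f) (D * expR (2 * C * t)).
  - by rewrite mulr_ge0 // expR_ge0.
  - by rewrite mulrAC; exact: Ydiff.
  - by exists l.
pose y t f := y' (t, f).
have yP m t f : 0 <= t -> `|y t f - Y m t f| <= 2 * (D / 2 ^+ m * expR (2 * C * t)).
  by move=> t0; apply: le_trans (y'P (t, f) m t0) _; rewrite /= !mulrA mulrAC.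
have yc : cont y.
  move=> f t; apply/cvgrPdist_lt => e e0.
  pose M := expR (2 * C * (`|t| + 1)).
  have [m mP] : exists m, 2 * D * M / 2 ^+ m < e / 3.
    by apply: geometric_small; rewrite divr_gt0.
  have bnd (s : R) : `|s| <= `|t| + 1 -> `|y `|s| f - Y m `|s| f| < e / 3.
    move=> st; apply: le_lt_trans (yP m _ f (normr_ge0 s)) _.
    apply: le_lt_trans mP; rewrite (_ : 2 * D * M / 2 ^+ m = 2 * (D / 2 ^+ m * M)).
      rewrite ler_pM2l //; apply: ler_wpM2l; first by rewrite divr_ge0 // ltW.
      by rewrite ler_expR ler_pM2l // mulr_gt0.
    by ring.
  have := Yc m f t => /cvgrPdist_lt/(_ (e / 3)).
  rewrite divr_gt0 // => /(_ isT) h.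
  have : \forall s \near t, `|s| < `|t| + 1.
    by apply: cvgr_lt (@norm_continuous R R^o t) _ _; rewrite ltrDl.
  apply: filterS2 h => s sY st.
  have b1 := bnd s (ltW st).
  have b2 : `|y `|t| f - Y m `|t| f| < e / 3 by apply: bnd; rewrite lerDl.
  move: b1 b2 sY; rewrite !ltr_norml; lra.
exists (step y); have [z0 zd] := stepP y yc; split => // t f t0.
suff zy : forall f, step y t f = y t f.
  have -> : G (step y t) f = G (y t) f by congr (G _ f); apply/funext.
  exact: zd.
move=> {}f; apply/eqP; rewrite -subr_eq0 -normr_le0; apply/ler_addgt0Pl => e e0.
rewrite addr0.
have [m mP] : exists m, 2 * D * expR (2 * C * t) / 2 ^+ m < e.
  exact: geometric_small.
have zY : `|step y t f - Y m.+1 t f| <= D / 2 ^+ m * expR (2 * C * t).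
  have D1 : 0 <= D / 2 ^+ m by rewrite divr_ge0 // ltW.
  have zY0 g : step y 0 g = Y m.+1 0 g by rewrite z0 Y0.
  apply: (diff_bound (step y) (Y m.+1) (fun t => G (y t)) (fun t => G (Y m t)) _
    D1 zY0 zd (YS m)) => // s g s0.
  apply: le_trans (@G_lip _ _ _ g (fun h => yP m s h s0)) _.
  by rewrite mulrCA -!mulrA.
have := yP m.+1 t f t0; rewrite distrC => yY.
rewrite -(subrKA (Y m.+1 t f)); apply: le_trans (ler_normD _ _) _.
apply: le_trans (lerD zY yY) _; apply/ltW/(le_lt_trans _ mP).
rewrite le_eqVlt; apply/orP; left; apply/eqP.
by rewrite exprS; field; rewrite lt0r_neq0.
Qed.

End Picard.

(** * The flow in logarithmic coordinates *)

Section Decay.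
Variables (R : realType) (I : finType) (z dz : I -> R -> R) (eps : R).
Hypothesis eps_gt0 : 0 < eps.
Hypothesis z_derive : forall i (t : R), 0 <= t -> is_derive t 1 (z i) (dz i t).
Hypothesis z_decr : forall i (t b : R), 0 <= t -> 0 < b -> (forall j, z j t <= b) ->
  z i t = b -> dz i t <= - eps.

(** The maximum of the [z i] decreases at rate at least [eps] while it is
positive.  It is compared with [M * expR (- gam * t)], whose slope never
exceeds [eps / 2] in absolute value. *)
Lemma max_decay (eta : R) : 0 < eta -> \forall t \near +oo, forall i, z i t < eta.
Proof.
move=> eta0; pose M := 1 + \sum_i `|z i 0|.
have M0 : 0 < M by rewrite ltr_pwDl // sumr_ge0.
pose gam := eps / (2 * M).
have gam0 : 0 < gam by rewrite divr_gt0 // mulr_gt0.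
pose b t := M * expR (- gam * t).
have b0 t : 0 < b t by rewrite mulr_gt0 // expR_gt0.
have db (t : R) : is_derive t 1 b (- (gam * b t)).
  have h := is_derive_expR_scaled (- gam) t.
  have := is_deriveZ M h; move=> H; apply: (is_derive_eq H).
  by rewrite /GRing.scale /b /=; ring.
have zb i t : 0 <= t -> z i t - b t < 0.
  apply: (@first_touch R I (fun i t => z i t - b t)
    (fun i t => dz i t + gam * b t)).
  - move=> j; apply: cvg_at_right_filter.
    apply: cvgB; first exact: is_derive_continuous (z_derive j (lexx 0)).
    exact: is_derive_continuous (db 0).
  - move=> j s s0; have h := is_deriveB (z_derive j (ltW s0)) (db s).
    by apply: (is_derive_eq h); rewrite opprK.
  - move=> j; rewrite /b mulr0 expR0 mulr1 /M (bigD1 j) //=.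
    have := ler_norm (z j 0).
    have : 0 <= \sum_(i | i != j) `|z i 0| by apply: sumr_ge0.
    lra.
  move=> j s s0 zle zj.
  have bM : b s <= M.
    apply: ler_piMr; first exact: ltW.
    by rewrite -[leRHS]expR0 ler_expR ltW // mulNr oppr_lt0 mulr_gt0.
  have : dz j s <= - eps.
    apply: (@z_decr j s (b s)); rewrite ?ltW //.
      by move=> k; rewrite -subr_le0.
    by apply/eqP; rewrite -subr_eq0 zj.
  have : gam * b s <= gam * M by rewrite ler_pM2l.
  have -> : gam * M = eps / 2 by rewrite /gam; field; rewrite lt0r_neq0.
  have := eps_gt0; lra.
near=> t => i; have t0 : 0 <= t by near: t; apply: nbhs_pinfty_ge; exact: num_real.
have := zb i t t0; rewrite subr_lt0 => /lt_trans; apply.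
rewrite /b mulrC -ltr_pdivlMr // -[ltRHS]lnK ?posrE ?divr_gt0 //.
rewrite ltr_expR mulNr ltrNl -ltr_pdivrMl //.
by near: t; apply: nbhs_pinfty_gt; exact: num_real.
Unshelve. all: by end_near. Qed.

End Decay.

Section Flow.
Variables (R : realType) (E : finType) (n : nat).
Variables (f1 f2 : E -> 'I_n) (Phi : E -> R).
Hypothesis PhiP : forall e, 0 < Phi e < pi / 2.
Hypothesis incident : forall f, exists e, f1 e = f \/ f2 e = f.
Variable lam : 'I_n -> R.
Hypothesis lam_ge0 : forall f, 0 <= lam f.
Local Notation curv := (curv f1 f2 Phi).

Definition log_field (K : 'I_n -> R) f := lam f - curv (fun g => expR (K g)) f.

Definition log_field_lip : R := 1 + \sum_(e : E) ((pi + 4) + (pi + 4)).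

Lemma log_field_lip_gt0 : 0 < log_field_lip.
Proof.
by rewrite ltr_pwDl // sumr_ge0 // => e _; have := @pi_ge0 R; lra.
Qed.

Lemma log_field_lipschitz K K' (m : R) f : (forall g, `|K g - K' g| <= m) ->
  `|log_field K f - log_field K' f| <= log_field_lip * m.
Proof.
move=> Km; have m0 : 0 <= m by apply: le_trans (Km f).
have -> : log_field K f - log_field K' f =
    curv (fun g => expR (K' g)) f - curv (fun g => expR (K g)) f.
  by rewrite /log_field; ring.
rewrite distrC /log_field_lip mulrDl mul1r.
apply: le_trans (curv_lipschitz f1 f2 PhiP f Km) _.
by rewrite lerDr.
Qed.

Lemma log_flow_exists (K0 : 'I_n -> R) : exists K : R -> 'I_n -> R,
  (forall f, K 0 f = K0 f) /\
  forall (t : R) f, 0 <= t -> is_derive t 1 (fun s => K s f) (log_field (K t) f).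
Proof. exact: (global_solution log_field_lip_gt0 log_field_lipschitz). Qed.

Section Convergence.
Variables (K : R -> 'I_n -> R) (w : 'I_n -> R).
Hypothesis K_derive : forall (t : R) f, 0 <= t ->
  is_derive t 1 (fun s => K s f) (log_field (K t) f).
Hypothesis w_ge0 : forall f, 0 <= w f.
Hypothesis curv_w : forall f, curv w f = lam f.

(** Apply [max_decay] to [K - ln u].  Where it attains its maximum [b], the
comparison with the scaled metric [expR b * u] gives curvature at least
[lam f + eps]. *)
Lemma supersolution_absorbs (u : 'I_n -> R) eps eta : 0 < eps -> 0 < eta ->
  (forall f, 0 < u f) -> (forall f, curv u f = lam f + eps) ->
  \forall t \near +oo, forall f, expR (K t f) < expR eta * u f.
Proof.
move=> eps0 eta0 u0 uE.
have zd f (t : R) : 0 <= t ->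
    is_derive t 1 (fun s => K s f - ln (u f)) (log_field (K t) f).
  move=> t0; have h := is_deriveB (K_derive f t0) (is_derive_cst (ln (u f)) t 1).
  by apply: (is_derive_eq h); rewrite subr0.
have ue f b : expR (ln (u f) + b) = expR b * u f.
  by rewrite expRD lnK ?posrE // mulrC.
suff dec f (t b : R) : 0 <= t -> 0 < b -> (forall g, K t g - ln (u g) <= b) ->
    K t f - ln (u f) = b -> log_field (K t) f <= - eps.
  apply: filterS (max_decay eps0 zd dec eta0) => t h f.
  by rewrite -ue ltr_expR addrC -ltrBlDr.
move=> t0 b0 zb zf; rewrite /log_field.
suff : lam f + eps <= curv (fun g => expR (K t g)) f by lra.
rewrite -uE; apply: le_trans (_ : curv (fun g => expR b * u g) f <= _).
  by apply: curv_scale_le => // [g|]; rewrite ?(ltW (u0 g)) // -expR0 ler_expR ltW.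
apply: curv_quasi => [//|||g]; first exact: expR_ge0.
  by rewrite -ue -zf addrC subrK.
by rewrite -ue ler_expR addrC -lerBlDr.
Qed.

(** The shrunk metric [expR (- eta) * w] has curvature smaller than [lam] on
the support of [w], hence by a fixed amount there.  Then [max_decay] applies to
[ln u - K] on the support, and to a negative constant elsewhere. *)
Lemma subsolution_absorbed eta : 0 < eta ->
  \forall t \near +oo, forall f, 0 < w f ->
    expR (- (eta + eta)) * w f < expR (K t f).
Proof.
move=> eta0; pose u f := expR (- eta) * w f.
have ewu : (fun f => expR eta * u f) = w.
  by apply/funext => f; rewrite /u mulrA -expRD subrr expR0 mul1r.
have u0 f : 0 <= u f by rewrite mulr_ge0 // expR_ge0.
have [eps eps0 epsP] : exists2 eps, 0 < eps &
    forall f, 0 < w f -> curv u f + eps <= lam f.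
  have : \forall eps \near (0:R)^'+, forall f, 0 < w f -> curv u f + eps <= lam f.
    apply: filter_forall => f.
    have [w0|wf] := leP (w f) 0; first by near=> e.
    have uf : 0 < u f by rewrite mulr_gt0 // expR_gt0.
    have : curv u f < lam f.
      rewrite -curv_w -ewu; apply: curv_scale_lt => //.
      by rewrite -expR0 ltr_expR.
    rewrite -subr_gt0 => lt; near=> e => _.
    by rewrite addrC -lerBrDr; near: e; exact: nbhs_right_le.
  move=> h; have h0 := @nbhs_right_gt R 0.
  by have [e [e0 eP]] := filter_ex (filterI h0 h); exists e.
pose z f t := if 0 < w f then ln (u f) - K t f else -1.
pose dz f t := if 0 < w f then - log_field (K t) f else 0.
have zd f (t : R) : 0 <= t -> is_derive t 1 (z f) (dz f t).
  move=> t0; rewrite /z /dz; case: ifP => _; last exact: is_derive_cst.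
  have h := is_deriveB (is_derive_cst (ln (u f)) t 1) (K_derive f t0).
  by apply: (is_derive_eq h); rewrite sub0r.
have ue f b : 0 < w f -> expR (ln (u f) - b) = expR (- b) * u f.
  by move=> wf; rewrite expRD lnK 1?mulrC // posrE mulr_gt0 // expR_gt0.
suff dec f (t b : R) : 0 <= t -> 0 < b -> (forall g, z g t <= b) ->
    z f t = b -> dz f t <= - eps.
  apply: filterS (max_decay eps0 zd dec eta0) => t h f wf.
  have := h f; rewrite /z wf ltrBlDr -ltrBlDl => h'.
  by rewrite opprD expRD -mulrA -/(u f) -ue // ltr_expR.
move=> t0 b0 zb; rewrite {1}/z /dz; case: ifP => [wf zf|_]; last first.
  by move=> b1; move: b0; rewrite -b1; lra.
rewrite /log_field.
suff : curv (fun g => expR (K t g)) f <= curv u f by have := epsP f wf; lra.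
apply: (@le_trans _ _ (curv (fun g => expR (- b) * u g) f)).
  apply: curv_quasi => [//|||g].
  - by rewrite mulr_ge0 // expR_ge0.
  - by rewrite -ue // -zf; congr expR; ring.
  have [w0|wg] := leP (w g) 0.
    have -> : u g = 0.
      by rewrite /u (_ : w g = 0) ?mulr0 //; apply/eqP; rewrite eq_le w0 w_ge0.
    by rewrite mulr0 expR_ge0.
  by rewrite -ue // ler_expR; have := zb g; rewrite /z wg; lra.
rewrite [leRHS](_ : _ = curv (fun g => expR b * (expR (- b) * u g)) f).
  apply: curv_scale_le => // [g|]; first by rewrite mulr_ge0 // expR_ge0.
  by rewrite -expR0 ler_expR ltW.
congr (curv _ f); apply/funext => g.
by rewrite mulrA -expRD subrr expR0 mul1r.
Unshelve. all: by end_near. Qed.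

Lemma flow_converges : (forall d, 0 < d -> exists u eps, 0 < eps /\ forall f,
      [/\ 0 < u f, curv u f = lam f + eps, w f <= u f & u f < w f + d]) ->
  forall f, expR (K t f) @[t --> +oo] --> w f.
Proof.
move=> wP f; apply/cvgrPdist_lt => e e0.
have [u [eps [eps0 uP]]] := wP e e0.
have [uf _ _ ufw] := uP f.
(* This value of [eta] turns the bound [expR eta * u f] into [w f + e]. *)
have eta0 : 0 < ln ((w f + e) / u f).
  by rewrite ln_gt0 // ltr_pdivlMr // mul1r.
have up := supersolution_absorbs eps0 eta0 (fun g => let: And4 h _ _ _ := uP g in h)
  (fun g => let: And4 _ h _ _ := uP g in h).
have we0 : 0 < w f + e by exact: lt_trans ufw.
have [w0|wf] := leP (w f) 0.
  apply: filterS up => t /(_ f).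
  rewrite lnK ?posrE ?divr_gt0 // divfK ?lt0r_neq0 // => h.
  have := expR_gt0 (K t f); have := w_ge0 f; rewrite ltr_norml; lra.
(* This value gives [w f - e] as a lower bound, through [1 + x <= expR x]. *)
have eta1 : 0 < e / (2 * w f) by rewrite divr_gt0 // mulr_gt0.
apply: filterS2 up (subsolution_absorbed eta1) => t /(_ f) + /(_ f wf).
rewrite lnK ?posrE ?divr_gt0 // divfK ?lt0r_neq0 // => h1 h2.
have : (1 - (e / (2 * w f) + e / (2 * w f))) * w f <= 
   expR (- (e / (2 * w f) + e / (2 * w f))) * w f.
  by rewrite ler_pM2r // expR_ge1Dx.
have -> : (1 - (e / (2 * w f) + e / (2 * w f))) * w f = w f - e.
  by field; rewrite lt0r_neq0.
rewrite ltr_norml; lra.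
Qed.

End Convergence.

Section Uniqueness.
Variables (K x : R -> 'I_n -> R).
Hypothesis K_derive : forall (t : R) f, 0 <= t ->
  is_derive t 1 (fun s => K s f) (log_field (K t) f).
Hypothesis x_ge0 : forall (t : R) f, 0 <= t -> 0 <= x t f.
Hypothesis x_right0 : forall f, x t f @[t --> 0^'+] --> x 0 f.
Hypothesis x_derive : forall (t : R) f, 0 < t ->
  is_derive t 1 (fun s => x s f) (- (curv (x t) f - lam f) * x t f).
Hypothesis x0K0 : forall f, x 0 f = expR (K 0 f).

(** As [curv x] is bounded, no face can decay faster than exponentially. *)
Lemma flow_stays_positive t f : 0 <= t -> 0 < x t f.
Proof.
move=> t0; pose M := curv_bound R E + 1.
pose b g t := x 0 g / 2 * expR (- M * t).
have x00 g : 0 < x 0 g by rewrite x0K0 expR_gt0.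
have b0 g s : 0 < b g s by rewrite mulr_gt0 ?expR_gt0 // divr_gt0.
have db g (s : R) : is_derive s 1 (b g) (- M * b g s).
  have h := is_derive_expR_scaled (- M) s.
  have := is_deriveZ (x 0 g / 2) h; move=> H; apply: (is_derive_eq H).
  by rewrite /GRing.scale /b /=; ring.
pose z g s := b g s - x s g.
pose dz g s := - M * b g s - (- (curv (x s) g - lam g) * x s g).
have z_right0 g : z g s @[s --> 0^'+] --> z g 0.
  apply: cvgB; last exact: x_right0.
  by apply: cvg_at_right_filter; exact: is_derive_continuous (db g 0).
have z_derive g (s : R) : 0 < s -> is_derive s 1 (z g) (dz g s).
  by move=> s0; exact: (is_deriveB (db g s) (x_derive g s0)).
have z0 g : z g 0 < 0.
  by rewrite /z /b mulr0 expR0 mulr1; have := x00 g; lra.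
suff touch g (s : R) : 0 < s -> (forall h, z h s <= 0) -> z g s = 0 -> dz g s < 0.
  apply: lt_trans (b0 f t) _; rewrite -subr_lt0.
  exact: (first_touch z_right0 z_derive z0 touch f t0).
move=> s0 _ /eqP; rewrite /z subr_eq0 => /eqP bx; rewrite /dz -bx.
have -> : - M * b g s - - (curv (x s) g - lam g) * b g s =
    (curv (x s) g - lam g - M) * b g s by ring.
rewrite pmulr_llt0 // /M.
have : curv (x s) g <= curv_bound R E.
  by apply: curv_le_bound => // h; rewrite x_ge0 // ltW.
by have := lam_ge0 g; lra.
Qed.

(** Gronwall estimate: by [first_touch] the distance between [ln x] and [K],
which vanishes at 0, stays below [eta * expR ((C + 1) * t)] for every positive
[eta]. *)
Lemma flow_unique t f : 0 <= t -> x t f = expR (K t f).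
Proof.
move=> t0; have xp := flow_stays_positive.
suff h : ln (x t f) = K t f by rewrite -h lnK // posrE xp.
pose C := log_field_lip.
apply/eqP; rewrite -subr_eq0 -normr_le0; apply/ler_addgt0Pl => e e0; rewrite addr0.
pose eta := e / expR ((C + 1) * t).
have eta0 : 0 < eta by rewrite divr_gt0 // expR_gt0.
pose b (s : R) := eta * expR ((C + 1) * s).
have b0 s : 0 < b s by rewrite mulr_gt0 // expR_gt0.
have db (s : R) : is_derive s 1 b ((C + 1) * b s).
  have h := is_derive_expR_scaled (C + 1) s.
  have := is_deriveZ eta h; move=> H; apply: (is_derive_eq H).
  by rewrite /GRing.scale /b /=; ring.
(* The sign allows both bounds on [ln x - K] to be proved at once. *)
pose sg (c : bool) : R := if c then 1 else -1.
pose d s g := ln (x s g) - K s g.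
pose dd s g := log_field (fun h => ln (x s h)) g - log_field (K s) g.
have dlnx (s : R) g : 0 < s ->
    is_derive s 1 (fun r => ln (x r g)) (log_field (fun h => ln (x s h)) g).
  move=> s0; have xs := xp s g (ltW s0).
  have h := @is_derive1_comp R (@ln R) (fun r => x r g) s _ _
    (is_derive1_ln xs) (x_derive g s0).
  apply: (is_derive_eq h); rewrite /log_field.
  have -> : (fun h => expR (ln (x s h))) = x s.
    by apply/funext => k; rewrite lnK // posrE xp // ltW.
  by field; rewrite lt0r_neq0.
pose z (gc : 'I_n * bool) s := sg gc.2 * d s gc.1 - b s.
pose dz (gc : 'I_n * bool) s := sg gc.2 * dd s gc.1 - (C + 1) * b s.
have z_right0 gc : z gc s @[s --> 0^'+] --> z gc 0.
  apply: cvgB; last first.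
    by apply: cvg_at_right_filter; exact: is_derive_continuous (db 0).
  apply: cvgM; first exact: cvg_cst.
  apply: cvgB; last first.
    apply: cvg_at_right_filter.
    exact: is_derive_continuous (K_derive gc.1 (lexx 0)).
  have lnc : ln y @[y --> x 0 gc.1] --> ln (x 0 gc.1).
    by apply: continuous_ln; rewrite xp.
  exact: (cvg_comp _ _ (@x_right0 gc.1) lnc).
have z_derive gc (s : R) : 0 < s -> is_derive s 1 (z gc) (dz gc s).
  move=> s0.
  have h1 := is_deriveB (dlnx s gc.1 s0) (K_derive gc.1 (ltW s0)).
  exact: (is_deriveB (is_deriveZ (sg gc.2) h1) (db s)).
have z0 gc : z gc 0 < 0.
  by rewrite /z /d x0K0 expRK subrr mulr0 sub0r oppr_lt0.
have touch gc (s : R) : 0 < s -> (forall hc, z hc s <= 0) -> z gc s = 0 ->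
    dz gc s < 0.
  move=> s0 zle _.
  have dabs k : `|ln (x s k) - K s k| <= b s.
    have := zle (k, true); have := zle (k, false); rewrite /z /sg /d /=.
    by rewrite ler_norml; lra.
  have := log_field_lipschitz gc.1 dabs; rewrite -/C -/(dd s gc.1) ler_norml.
  have := b0 s; rewrite /dz /sg.
  by case: gc.2 => ? /andP[]; rewrite ?mul1r ?mulN1r; lra.
have dle c : sg c * d t f - b t < 0.
  exact: (first_touch z_right0 z_derive z0 touch (f, c) t0).
have bt : b t = e by rewrite /b /eta divfK // lt0r_neq0 // expR_gt0.
have := dle true; have := dle false.
by rewrite bt /sg /d ler_norml; lra.
Qed.

End Uniqueness.
End Flow.

(** * From the cell decomposition to the network of faces *)

Section Incidence.
Variables (R : realType) (S : topologicalType) (V E F : finType).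
Variable X : cellular_decomposition R S V E F.

Lemma cell_inj (c c' : V + E + F) (x : S) : cell X c x -> cell X c' x -> c = c'.
Proof.
move=> cx c'x; apply: (@cell_disjoint _ _ _ _ _ X) => //.
by exists x.
Qed.

(** If the edge lies in the closure of the face [c], then its bicollar meets
[c], outside of the edge; as distinct cells are disjoint, this happens in the
half of [f] or of [g].  Conversely every point of the edge is a limit of points
of both halves. *)
Lemma mem_boundary_edges (e : E) (f g c : F) : two_sides X e f g ->
  (e \in boundary_edges X c) = (f == c) || (g == c).
Proof.
move=> [h [[hc hinj hopen] h0 hf hg]].
have edge_h p : p.2 = 0 -> cell X (inl (inr e)) (h p).
  by move=> p0; rewrite -[cell X _]/(edge_cell X e) -h0; exists p.
have off_face x : cell X (inl (inr e)) x -> ~ cell X (inr c) x.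
  by move=> ex cx; have := cell_inj ex cx.
apply/idP/idP.
  rewrite inE => /asboolP sub.
  have [] : (closure (face_cell X c) `\` face_cell X c) (h (0, 0)).
    by apply: sub; exact: edge_h.
  move=> /(_ (h @` setT)) [|y [cy [p _ py]] _].
    by apply: open_nbhs_nbhs; split; [apply: hopen; exact: openT|exists (0, 0)].
  have [p2|p2|p2] := ltgtP p.2 0.
  - have gy : cell X (inr g) y by apply: hg; exists p.
    by have [->] := cell_inj gy cy; rewrite eqxx orbT.
  - have fy : cell X (inr f) y by apply: hf; exists p.
    by have [->] := cell_inj fy cy; rewrite eqxx.
  - by have := off_face y; rewrite -py => /(_ (edge_h p p2)); rewrite py.
move=> fgc; rewrite inE; apply/asboolP => x ex; split; last exact: off_face.
move: ex; rewrite -h0 => -[p /= p0 <-] B Bx.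
have /nbhs_ballP[d /= d0 dB] := hc p B Bx.
have near_axis t : `|t| < d -> B (h (p.1, t)).
  move=> td; apply: dB; split; first exact: ballxx.
  by rewrite /ball /= p0 sub0r normrN.
have d2 : `|d / 2| < d by rewrite ger0_norm; lra.
case/orP: fgc => /eqP <-.
- exists (h (p.1, d / 2)); split; last exact: near_axis.
  by apply: hf; exists (p.1, d / 2) => //=; rewrite divr_gt0.
- exists (h (p.1, - (d / 2))); split; last by apply: near_axis; rewrite normrN.
  by apply: hg; exists (p.1, - (d / 2)) => //=; rewrite oppr_lt0 divr_gt0.
Qed.

End Incidence.

Section Bridge.
Variables (R : realType) (E : finType) (n : nat).
Variables (bd : 'I_n -> {set E}) (f1 f2 : E -> 'I_n) (Phi : E -> R).
Hypothesis bdP : forall e f, (e \in bd f) = (f1 e == f) || (f2 e == f).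
Hypothesis PhiP : forall e, 0 < Phi e < pi / 2.
Implicit Types (k L : 'cV[R]_n) (I : {set 'I_n}).

Lemma total_curvatureE k f : (forall g, 0 <= k g 0) ->
  total_curvature bd f1 f2 Phi k f 0 = curv f1 f2 Phi (fun g => k g 0) f.
Proof.
move=> k0; rewrite mxE /curv big_mkcond /=; apply: eq_bigr => e _.
rewrite bdP !side_curvatureE //.
by case: eqP => _; case: eqP => _ //=; rewrite addr0.
Qed.

Lemma sum_edges_of (A : {set 'I_n}) :
  \sum_(e in edges_of bd A) Phi e = \sum_(e | (f1 e \in A) || (f2 e \in A)) Phi e.
Proof.
apply: eq_bigl => e; rewrite inE; apply/existsP/orP => [[f /andP[fA]]|].
  by rewrite bdP => /orP[] /eqP ef; [left|right]; rewrite ef.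
by move=> [] fA; [exists (f1 e)|exists (f2 e)]; rewrite fA bdP eqxx ?orbT.
Qed.

(** Outside of [I] the prescribed curvature is 0, so both cases of the flow
have the same form. *)
Lemma flow_fieldE I L k f : (forall g, 0 <= k g 0) ->
  (forall g, g \notin I -> L g 0 = 0) ->
  flow_field bd f1 f2 Phi I L k f 0 =
  - (curv f1 f2 Phi (fun g => k g 0) f - L f 0) * k f 0.
Proof.
move=> k0 LI; rewrite mxE total_curvatureE //; case: ifPn => // /LI ->.
by rewrite subr0.
Qed.

(** The condition on subsets of [I] extends to all sets of faces: the other
faces add 0 on the left and a nonnegative amount on the right.  When [A] is
disjoint from [I], the left-hand side is 0 and the right-hand side is positive
because every face has an edge. *)
Lemma admissible_sum_lt I L (A : {set 'I_n}) :
  (forall f, exists e, f1 e = f \/ f2 e = f) ->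
  admissible_curvature bd Phi I L -> A != finset.set0 ->
  \sum_(f in A) L f 0 < 2 * \sum_(e | (f1 e \in A) || (f2 e \in A)) Phi e.
Proof.
move=> inc [_ LI Llt] A0.
have Phi0 e : 0 < Phi e by have /andP[] := PhiP e.
have -> : \sum_(f in A) L f 0 = \sum_(f in (A :&: I)%SET) L f 0.
  rewrite [RHS]big_mkcond [LHS]big_mkcond /=; apply: eq_bigr => f _.
  by rewrite inE; case: (f \in A) => //=; case: ifPn => // /LI.
have [AI|AI] := eqVneq (A :&: I)%SET finset.set0.
  rewrite AI big1 => [|f]; last by rewrite inE.
  rewrite mulr_gt0 //; have /set0Pn[f fA] := A0; have [e fe] := inc f.
  rewrite (bigD1 e) /=; last by case: fe => ->; rewrite fA ?orbT.
  by rewrite ltr_pwDl // sumr_ge0 // => e1 _; exact: ltW.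
apply: lt_le_trans (Llt _ AI (finset.subsetIr _ _)) _.
rewrite ler_pM2l // sum_edges_of big_mkcond [leRHS]big_mkcond /=.
apply: ler_sum => e _; rewrite !inE.
by have := ltW (Phi0 e); case: (f1 e \in A); case: (f2 e \in A) => //=;
  case: (f1 e \in I); case: (f2 e \in I).
Qed.

End Bridge.

Section ColumnVectors.
Variables (R : realType) (n : nat).

Lemma col_cvg (T : Type) (F : set_system T) {FF : Filter F}
    (U : T -> 'I_n -> R) (u : 'I_n -> R) :
  (forall f, U t f @[t --> F] --> u f) ->
  (\col_f U t f : 'cV[R]_n) @[t --> F] --> (\col_f u f : 'cV[R]_n).
Proof.
move=> Uu; apply/cvg_ballP => e e0.
have : \forall t \near F, forall f, ball (u f) e (U t f).
  by apply: filter_forall => f; have /cvg_ballP := Uu f; apply.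
by apply: filterS => t tP; split => // i j; rewrite !mxE.
Qed.

Lemma coord_right_cvg (k : R -> 'cV[R]_n) f :
  {within `[0, +oo[, continuous k} -> k t f 0 @[t --> 0^'+] --> k 0 f 0.
Proof.
move=> kc.
have : {within `[0, +oo[, continuous (fun t => k t f 0)}.
  move=> t; apply: (@continuous_comp _ _ _ (k : subspace _ -> _)
    (fun M : 'cV[R]_n => M f 0)); first exact: kc.
  exact: coord_continuous.
by case/continuous_within_itvcyP.
Qed.

End ColumnVectors.

Theorem theorem1p12 (R : realType) (S : topologicalType) (V E : finType)
    (n : nat) (X : cellular_decomposition R S V E 'I_n)
    (f1 f2 : E -> 'I_n) (Phi : E -> R)
    (m : nat) (i : 'I_m -> 'I_n) (Lhat : 'cV[R]_n)
    (surfaceS : closed_surface R S)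
    (sidesE : forall e, two_sides X e (f1 e) (f2 e))
    (edgeF : forall f, exists e, e \in boundary_edges X f)
    (weightPhi : forall e, 0 < Phi e < pi / 2)
    (mP : (1 <= m <= n - 1)%N)
    (iP : forall a b : 'I_m, (a < b)%N -> (i a < i b)%N)
    (LhatP : admissible_curvature (boundary_edges X) Phi (i @: 'I_m) Lhat) :
  exists khat : 'cV[R]_n,
    [/\ unique (fun k => degenerated_metric k /\
          total_curvature (boundary_edges X) f1 f2 Phi k = Lhat) khat,
        forall k0 : 'cV[R]_n, (forall f, 0 < k0 f 0) ->
          exists k : R -> 'cV[R]_n,
            [/\ flow_solution (boundary_edges X) f1 f2 Phi (i @: 'I_m)
                  Lhat k0 k,
                forall k', flow_solution (boundary_edges X) f1 f2 Phi
                  (i @: 'I_m) Lhat k0 k' -> forall t, 0 <= t -> k' t = k t &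
                k t @[t --> +oo] --> khat] &
        positive_on (i @: 'I_m) khat].
Proof.
have bdP e f : (e \in boundary_edges X f) = (f1 e == f) || (f2 e == f).
  exact: mem_boundary_edges.
have inc f : exists e, f1 e = f \/ f2 e = f.
  have [e] := edgeF f; rewrite bdP => /orP[] /eqP; exists e; tauto.
have [Lpos Lzero _] := LhatP.
pose lam f : R := Lhat f 0.
have lam0 f : 0 <= lam f.
  have [/Lpos/ltW//|/Lzero fI] := boolP (f \in i @: 'I_m).
  by rewrite /lam fI.
have lam_lt A : A != finset.set0 ->
    \sum_(f in A) lam f < 2 * \sum_(e | (f1 e \in A) || (f2 e \in A)) Phi e.
  exact: (admissible_sum_lt bdP weightPhi inc LhatP).
have [w [w0 wE wP]] := curv_degenerate weightPhi inc lam0 lam_lt.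
have pos_iff u f : (forall g, 0 <= u g) -> curv f1 f2 Phi u f = lam f ->
    (0 < u f) = (f \in i @: 'I_m).
  move=> u0 uE; apply/idP/idP => [uf|fI].
    apply/negPn/negP => /Lzero fI; have := curv_gt0 Phi inc uf.
    by rewrite uE /lam fI ltxx.
  rewrite lt_neqAle u0 andbT eq_sym; apply/eqP => uf.
  have := curv_eq0 f1 f2 Phi uf; rewrite uE => lf.
  by have := Lpos f fI; rewrite -/(lam f) lf ltxx.
have [f0 f0I] : exists f0, f0 \notin i @: 'I_m.
  apply/existsP; rewrite -negb_forall; apply/negP => /forallP all_in.
  have : (#|i @: 'I_m| <= m)%N.
    by apply: leq_trans (leq_imset_card _ _) _; rewrite card_ord.
  have -> : i @: 'I_m = finset.setT by apply/setP => f; rewrite all_in inE.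
  have /andP[m1 mn] := mP; have := leq_trans m1 mn; rewrite subn_gt0 => n1.
  rewrite cardsT card_ord leqNgt (leq_ltn_trans mn) // ltn_subrL.
  exact: ltnW.
exists (\col_f w f); split; last first.
- split => f fI; rewrite mxE.
    by rewrite (pos_iff w).
  by apply/eqP; rewrite eq_le w0 andbT leNgt (pos_iff w) // fI.
- move=> k0 k00.
  have [K [K0 KD]] := log_flow_exists f1 f2 weightPhi lam (fun f => ln (k0 f 0)).
  have eK0 f : expR (K 0 f) = k0 f 0 by rewrite K0 lnK // posrE.
  pose k t : 'cV[R]_n := \col_f expR (K t f).
  have kcoord t : (fun g => k t g 0) = fun g => expR (K t g).
    by apply/funext => g; rewrite mxE.
  exists k; split.
  + split.
    * by apply/colP => f; rewrite mxE.
    * by move=> t t0 f; rewrite mxE expR_ge0.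
    * apply: continuous_in_subspaceT => t; rewrite inE /= in_itv /= andbT => t0.
      apply: col_cvg => f.
      have Kc := is_derive_continuous (KD t f t0).
      exact: (cvg_comp _ _ Kc (@continuous_expR R _)).
    * move=> t t0 f; rewrite flow_fieldE // => [|g]; last by rewrite mxE expR_ge0.
      have -> : (fun s => k s f 0) = expR \o (fun s => K s f).
        by apply/funext => s; rewrite mxE.
      have h := @is_derive1_comp R expR (fun s => K s f) t _ _
        (is_derive_expR _) (KD t f (ltW t0)).
      by apply: (is_derive_eq h); rewrite kcoord mxE /log_field /lam; ring.
  + move=> k' [k'0 k'pos k'c k'd] t t0; apply/colP => f; rewrite [RHS]mxE.
    pose x s g := k' s g 0.
    have xd (s : R) g : 0 < s -> is_derive s 1 (fun r => x r g)
        (- (curv f1 f2 Phi (x s) g - lam g) * x s g).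
      move=> s0; have := k'd s s0 g; rewrite flow_fieldE //.
      by move=> h; exact: k'pos s (ltW s0) h.
    have x0 g : x 0 g = expR (K 0 g) by rewrite /x k'0 eK0.
    apply: (flow_unique weightPhi lam0 KD _ _ xd x0 f t0) => [s g s0|g].
      exact: k'pos.
    exact: coord_right_cvg.
  + by apply: col_cvg; exact: (flow_converges weightPhi inc KD w0 wE wP).
split.
  split.
    split; first by move=> f; rewrite mxE.
    by exists f0; rewrite mxE; apply/eqP; rewrite eq_le w0 andbT leNgt (pos_iff w).
  apply/colP => f; rewrite total_curvatureE //; last by move=> g; rewrite mxE.
  by rewrite -/(lam f) -wE; congr curv; apply/funext => g; rewrite mxE.
move=> k [[k0 _] kL]; apply/colP => f; rewrite mxE.
have kE g : curv f1 f2 Phi (fun g => k g 0) g = lam g.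
  by rewrite -(total_curvatureE bdP weightPhi) // kL.
(* Both metrics are positive exactly on the prescribed set of faces, so the
   comparison applies in both directions. *)
have half u v : (forall g, 0 <= u g) -> (forall g, 0 <= v g) ->
    (forall g, curv f1 f2 Phi u g = lam g) ->
    (forall g, curv f1 f2 Phi v g = lam g) ->
    u f <= v f.
  move=> u0 v0 uE vE; apply: (curv_comparison weightPhi inc) => // g ug.
  by rewrite uE vE (pos_iff v) // -(pos_iff u).
by apply/eqP; rewrite eq_le (half w (fun g => k g 0)) // (half (fun g => k g 0) w).
Qed.
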